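(* Let $\mathbb{G}$ be a self-affine carpet with attractor $\Lambda$ such that at least one of the following holds: (a) both $\mathrm{p}_1\mathbb{G}$ and $\mathrm{p}_2\mathbb{G}$ satisfy the weak separation condition; or (b) $\mathbb{G}$ satisfies coordinate ordering and the rectangular open set condition, and $\mathrm{p}_2\mathbb{G}$ satisfies the weak separation condition. For every $n\in\mathbb{N}^+$ let $d_n^1$ and $d_n^2$ be the unique real solutions of $$1=\sum_{S\in\mathbb{G}_n}\left(\frac{|r_{S,1}|}{|r_{S,2}|}\right)^{\dim_{\mathrm B}(\mathrm{p}_1\Lambda)}|r_{S,2}|^{d_n^1},\qquad 1=\sum_{S\in\mathbb{G}_n}\left(\frac{|r_{S,2}|}{|r_{S,1}|}\right)^{\dim_{\mathrm B}(\mathrm{p}_2\Lambda)}|r_{S,1}|^{d_n^2}.$$ Then the box-counting dimension of $\Lambda$ exists and $$\dim_{\mathrm B}(\Lambda)=\limsup_{n\to\infty}\max\{d_n^1,d_n^2\}.$$ Furthermore, for any fixed $\ell\in\{1,2\}$ such that $\mathrm{p}_\ell\mathbb{G}$ satisfies the weak separation condition, the formula remains valid if the equation defining $d_n^\ell$ is replaced by $$1=\sum_{S\in\mathbb{G}_n}\left(\frac{|r_{S,\ell}|}{|r_{S,3-\ell}|}\right)^{s_n^\ell}|r_{S,3-\ell}|^{d_n^\ell},$$ where $s_n^\ell$ is the unique real solution of $\sum_{R\in\mathrm{p}_\ell\mathbb{G}_n}|r_R|^{s_n^\ell}=1$, with $|r_R|$ the contraction ratio of the similarity $R$.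
   Context: A self-affine carpet is a finite set $\mathbb{G}$ of maps $S(x,y)=(r_{S,1}x+t_{S,1},\,r_{S,2}y+t_{S,2})$ of $\mathbb{R}^2$ with $|r_{S,\ell}|\in(0,1)$. Its attractor $\Lambda$ is the unique non-empty compact set with $\Lambda=\bigcup_{S\in\mathbb{G}}S(\Lambda)$. Write $\mathrm{p}_1(x,y)=x$, $\mathrm{p}_2(x,y)=y$; for a map $S$ of the form $S(x,y)=(r_{S,1}x+t_{S,1},\,r_{S,2}y+t_{S,2})$ with $|r_{S,\ell}|\in(0,1)$, $\mathrm{p}_\ell S$ is the map $u\mapsto r_{S,\ell}u+t_{S,\ell}$ of $\mathbb{R}$. For a finite set $\mathbb{F}$ of such maps, $\mathrm{p}_\ell\mathbb{F}=\{\mathrm{p}_\ell S:S\in\mathbb{F}\}$ as a set; $\mathrm{p}_\ell\mathbb{G}$ is a self-similar IFS on $\mathbb{R}$ with attractor $\mathrm{p}_\ell\Lambda$ (whose box-counting dimension exists, as for every self-similar set). Standing assumption: $\mathrm{conv}(\mathrm{p}_1\Lambda)\times\mathrm{conv}(\mathrm{p}_2\Lambda)=[0,1]^2$. $\mathbb{G}_n=\{S_1\circ\dots\circ S_n:S_i\in\mathbb{G}\}$ as a set of maps (again of the form $S(x,y)=(r_{S,1}x+t_{S,1},\,r_{S,2}y+t_{S,2})$ with $|r_{S,\ell}|\in(0,1)$). Coordinate ordering: $|r_{S,1}|\le|r_{S,2}|$ for all $S\in\mathbb{G}$. Rectangular open set condition: $S((0,1)^2)\cap\hat S((0,1)^2)=\emptyset$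 for all $S\ne\hat S\in\mathbb{G}$. A self-similar IFS $\mathbb{F}$ satisfies the weak separation condition if the identity map is an isolated point of $\{S^{-1}\circ\hat S:S,\hat S\in\mathbb{F}^*\}$, where $\mathbb{F}^*$ is the set of all finite compositions (of length $\geq 1$) of maps of $\mathbb{F}$. *)

(* Defs.v *)
From mathcomp Require Import all_boot all_order all_algebra finmap.
From mathcomp Require Import all_classical all_reals all_analysis.
From mathcomp Require Import ring.

Set Implicit Arguments.
Unset Strict Implicit.
Unset Printing Implicit Defensive.

Import Order.TTheory GRing.Theory Num.Theory numFieldNormedType.Exports.

Local Open Scope classical_set_scope.
Local Open Scope ring_scope.

Variant axis := axis1 | axis2.

Definition other (l : axis) : axis := if l is axis1 then axis2 else axis1.

(* Applies to points of R * R and, since a plane map below is the pair of its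
   coordinate maps, also to plane maps. *)
Definition axis_proj (A : Type) (l : axis) (z : A * A) : A :=
  if l is axis1 then z.1 else z.2.

(* Maps are encoded by their coefficients, which they determine (sim_fun_inj,
   map_fun_inj); finite sets of coefficients are thus finite sets of maps. *)

(* (r, t) stands for u |-> r * u + t *)
Notation similarity R := (R * R)%type (only parsing).

(* ((r1, t1), (r2, t2)) stands for (x, y) |-> (r1 * x + t1, r2 * y + t2) *)
Notation plane_map R := (similarity R * similarity R)%type (only parsing).

Section Maps.
Variable R : realType.
Implicit Types (f g : similarity R) (S T : plane_map R).

Definition slope f : R := f.1.
Definition sim_fun f : R -> R := fun u => f.1 * u + f.2.
Definition sim_id : similarity R := (1, 0).
Definition sim_comp f g : similarity R := (f.1 * g.1, f.1 * g.2 + f.2).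
Definition sim_inv f : similarity R := (f.1^-1, - (f.1^-1 * f.2)).

Definition map_fun S : R * R -> R * R :=
  fun z => (sim_fun S.1 z.1, sim_fun S.2 z.2).
Definition map_id : plane_map R := (sim_id, sim_id).
Definition map_comp S T : plane_map R :=
  (sim_comp S.1 T.1, sim_comp S.2 T.2).

Lemma sim_fun_inj : injective sim_fun.
Proof.
move=> [r t] [r' t'] /funeqP e.
have := e 0; have := e 1; rewrite /sim_fun /= !mulr0 !add0r !mulr1 => h ht.
by congr pair => //; move: h; rewrite ht => /addIr.
Qed.

Lemma sim_fun_id : sim_fun sim_id = id.
Proof. by apply/funext => u; rewrite /sim_fun /= mul1r addr0. Qed.

Lemma sim_fun_comp f g : sim_fun (sim_comp f g) = sim_fun f \o sim_fun g.
Proof. by apply/funext => u; rewrite /sim_fun /=; ring. Qed.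

Lemma sim_fun_inv f : slope f != 0 ->
  cancel (sim_fun f) (sim_fun (sim_inv f)) /\
  cancel (sim_fun (sim_inv f)) (sim_fun f).
Proof.
rewrite /slope /sim_fun => f0; split => u /=.
  by rewrite mulrDr mulKf// addrK.
by rewrite mulrDr mulrN !mulVKf// subrK.
Qed.

Lemma map_fun_inj : injective map_fun.
Proof.
move=> [f1 f2] [g1 g2] /funeqP e; congr pair; apply: sim_fun_inj.
  by apply/funext => u; have [] := e (u, 0).
by apply/funext => u; have [] := e (0, u).
Qed.

Lemma map_fun_id : map_fun map_id = id.
Proof. by apply/funext => -[x y]; rewrite /map_fun /= sim_fun_id. Qed.

Lemma map_fun_comp S T : map_fun (map_comp S T) = map_fun S \o map_fun T.
Proof. by apply/funext => -[x y]; rewrite /map_fun /= !sim_fun_comp. Qed.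

End Maps.

Arguments sim_id {R}.
Arguments map_id {R}.

Section IFS.
Variable R : realType.
Implicit Types (F : {fset similarity R}) (G : {fset plane_map R}).

Definition sim_iter F (n : nat) : {fset similarity R} :=
  iter n (fun E => [fset sim_comp f g | f in F, g in E]%fset) [fset sim_id]%fset.

Definition map_iter G (n : nat) : {fset plane_map R} :=
  iter n (fun E => [fset map_comp S T | S in G, T in E]%fset) [fset map_id]%fset.

Definition proj_ifs (l : axis) G : {fset similarity R} :=
  [fset axis_proj l S | S in G]%fset.

Definition sim_star F : set (similarity R) :=
  [set f | exists2 n, (0 < n)%N & f \in sim_iter F n].

(* The topology on similarities is that of the coefficients (r, t) in R * R,
   equivalently that of pointwise convergence of the maps. *)
Definition weak_separation F : Prop :=
  isolated [set sim_comp (sim_inv f) g | f in sim_star F & g in sim_star F]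
           sim_id.

Definition carpet G : Prop :=
  forall S, S \in G -> forall l, 0 < `|slope (axis_proj l S)| < 1.

Definition attractor G (L : set (R * R)) : Prop :=
  [/\ L !=set0, compact L & L = \bigcup_(S in [set` G]) (map_fun S @` L)].

Definition convex_hull (A : set R) : set R := smallest (@convex_set R R^o) A.

Definition unit_square_hull (L : set (R * R)) : Prop :=
  convex_hull (axis_proj axis1 @` L) `*` convex_hull (axis_proj axis2 @` L)
    = `[0, 1] `*` `[0, 1].

Definition coordinate_ordering G : Prop :=
  forall S, S \in G ->
    `|slope (axis_proj axis1 S)| <= `|slope (axis_proj axis2 S)|.

Definition rectangular_osc G : Prop :=
  forall S T, S \in G -> T \in G -> S != T ->
    (map_fun S @` (`]0, 1[ `*` `]0, 1[)) `&`
    (map_fun T @` (`]0, 1[ `*` `]0, 1[)) = set0.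

(* With a = dim_B (p_l L) this is the equation defining d_n^l, with a = s_n^l
   the modified one. *)
Definition dim_equation G (l : axis) (n : nat) (a d : R) : Prop :=
  1 = \sum_(S <- map_iter G n)
        (`|slope (axis_proj l S)| / `|slope (axis_proj (other l) S)|) `^ a
        * `|slope (axis_proj (other l) S)| `^ d.

Definition proj_equation G (l : axis) (n : nat) (s : R) : Prop :=
  \sum_(f <- proj_ifs l (map_iter G n)) `|slope f| `^ s = 1.

End IFS.

Section BoxDimension.
Variables (R : realType) (V : normedModType R).
Implicit Types (A : set V) (delta : R).

Definition coverable A delta (n : nat) : Prop :=
  exists U : 'I_n -> set V,
    (forall i x y, U i x -> U i y -> `|x - y| <= delta) /\
    A `<=` \bigcup_i U i.

(* Least number of sets of diameter at most delta covering A. On R * R the norm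
   is the maximum norm, so these sets are the subsets of the axis-parallel
   closed squares of side delta. *)
Definition cover_number A delta : R :=
  inf [set (n%:R : R) | n in coverable A delta].

Definition box_ratio A delta : R := ln (cover_number A delta) / - ln delta.

Definition box_dim_exists A : Prop := cvg (box_ratio A delta @[delta --> 0^'+]).

Definition box_dim A : R := lim (box_ratio A delta @[delta --> 0^'+]).

End BoxDimension.

(* Main.v *)
(* Two one-sided estimates of the covering numbers of L are compared with the
   sums over G_n in the dimension equations.

   Upper bound, for any carpet: at scale d, stop each coding of a point of L
   when the shorter side of the image of the unit square first drops to d. A
   stopped image with long axis l is covered by about (long / d) ^ dim (p_l L)
   sets of diameter d. If all sums over the G_n of the summands of the
   dimension equation at an exponent s are bounded, summing over the O(log
   (1/d)) possible levels shows that the dimension is at most s.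

   Lower bound: the pair of contraction ratios takes polynomially many values
   on G_n, and separation (from the open set condition, or because under weak
   separation two maps with equal slopes have translations which coincide or
   differ by a fixed proportion of the ratio) splits G_n further into
   boundedly many colours. So up to a factor subexponential in n, the sum over
   G_n is attained by a family H of maps with the same ratios and disjoint
   boxes. The k-fold compositions of H again have disjoint boxes, all of the
   same shape, and a square whose side is the short side of these boxes meets
   at most 16 of them; letting k tend to infinity bounds the dimension from
   below.

   The one-dimensional facts (existence of the box dimension of p_l L without
   any separation, and s_n -> dim (p_l L) under weak separation) come from the
   same estimates applied to the diagonal carpet {(f, f) : f in p_l G}, whose
   attractor is isometric to p_l L. *)

Require Import Defs.
From mathcomp Require Import all_boot all_order all_algebra finmap.
From mathcomp Require Import all_classical all_reals all_analysis.
From mathcomp Require Import ring lra zify.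

Set Implicit Arguments.
Unset Strict Implicit.
Unset Printing Implicit Defensive.

Import Order.TTheory GRing.Theory Num.Theory numFieldNormedType.Exports.

Local Open Scope classical_set_scope.
Local Open Scope ring_scope.

(* The lemmas [map_comp] and [map_id] of seq shadow the plane maps. *)
Local Notation map_comp := Defs.map_comp.
Local Notation map_id := Defs.map_id.

(** * Covering numbers *)

Lemma other_axisK (l : axis) : other (other l) = l.
Proof. by case: l. Qed.

Section CoverNumber.
Variables (R : realType) (V : normedModType R).
Implicit Types (A B : set V) (delta : R).

Lemma coverable_subset A B delta n :
  A `<=` B -> coverable B delta n -> coverable A delta n.
Proof. by move=> AB [U [U1 U2]]; exists U; split=> // x /AB /U2. Qed.

Lemma coverable_le_diam A d e n : d <= e -> coverable A d n -> coverable A e n.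
Proof.
move=> de [U [U1 U2]]; exists U; split=> // i x y Ux Uy.
exact: le_trans (U1 _ _ _ Ux Uy) de.
Qed.

(** Lets covers be indexed by cells, pairs or selected indices; [P] keeps only the pieces that are
    to be counted. *)
Lemma coverable_finType A delta (T : finType) (P : pred T) (U : T -> set V) :
  (forall i x y, P i -> U i x -> U i y -> `|x - y| <= delta) ->
  (forall x, A x -> exists2 i, P i & U i x) -> coverable A delta #|P|.
Proof.
move=> U1 U2; exists (fun i : 'I_#|P| => U (enum_val i)); split.
  by move=> i x y; apply: U1; apply: (enum_valP i).
move=> x /U2[i Pi Uix]; exists (enum_rank_in Pi i) => //=.
by rewrite enum_rankK_in.
Qed.

Lemma coverable_pos A delta n : A !=set0 -> coverable A delta n -> (0 < n)%N.
Proof. by move=> [x Ax] [U [_ /(_ x Ax)[[i ni] _ _]]]; case: n U i ni. Qed.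

Lemma coverable_setU A B delta m n :
  coverable A delta m -> coverable B delta n ->
    coverable (A `|` B) delta (m + n).
Proof.
move=> [U [U1 U2]] [W [W1 W2]].
exists (fun i => match fintype.split i with inl j => U j | inr j => W j end);
  split.
  by move=> i x y; case: fintype.split => j; [apply: U1 | apply: W1].
move=> x [/U2[j _ Ujx]|/W2[j _ Wjx]].
  exists (lshift n j) => //=; case: fintype.splitP => k /= jk.
    by rewrite (_ : k = j)//; apply/val_inj.
  by have := ltn_ord j; rewrite jk ltnNge leq_addr.
exists (rshift m j) => //=; case: fintype.splitP => k /= jk.
  by have := ltn_ord k; rewrite -jk ltnNge leq_addr.
by rewrite (_ : k = j)//; apply/val_inj/eqP; rewrite -(eqn_add2l m) jk.
Qed.

Lemma coverable_seq (I : eqType) (E : seq I) (B : I -> set V) (m : I -> nat)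
    A delta :
  (forall x, A x -> exists2 i, i \in E & B i x) ->
  (forall i, i \in E -> coverable (B i) delta (m i)) ->
  coverable A delta (\sum_(i <- E) m i).
Proof.
elim: E A => [|i E IH] A AE BE.
  rewrite big_nil; exists (fun=> set0); split=> // x /AE[i].
  by rewrite in_nil.
rewrite big_cons; apply: (@coverable_subset _
    (B i `|` [set x | exists2 j, j \in E & B j x])).
  move=> x /AE[j]; rewrite inE => /predU1P[->|jE] Bjx; first by left.
  by right; exists j.
apply: coverable_setU; first by apply: BE; rewrite mem_head.
by apply: IH => // j jE; apply: BE; rewrite inE jE orbT.
Qed.

(** An infimum of natural numbers is attained, so the real [cover_number] can be traded for a
    natural [m] in the counting arguments. *)
Lemma cover_numberP A delta n : coverable A delta n ->
  exists m, [/\ coverable A delta m, cover_number A delta = m%:R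
    & forall k, coverable A delta k -> (m <= k)%N].
Proof.
move=> An; have ex : exists n, `[< coverable A delta n >].
  by exists n; apply/asboolP.
have [m /asboolP Am mmin] := ex_minnP ex; exists m; split=> //; last first.
  by move=> k /asboolP; apply: mmin.
apply/eqP; rewrite eq_le; apply/andP; split.
  apply: ge_inf; last by exists m.
  by exists 0 => _ [k _ <-].
apply: lb_le_inf; first by exists m%:R, m.
by move=> _ [k /asboolP Ak <-]; rewrite ler_nat mmin.
Qed.

Lemma cover_number_le A delta n :
  coverable A delta n -> cover_number A delta <= n%:R.
Proof.
by move=> An; have [m [_ -> /(_ _ An)]] := cover_numberP An; rewrite ler_nat.
Qed.

Lemma cover_number_ge1 A delta n :
  A !=set0 -> coverable A delta n -> 1 <= cover_number A delta.
Proof.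
move=> A0 An; have [m [Am -> _]] := cover_numberP An.
by rewrite ler1n (coverable_pos A0 Am).
Qed.

Lemma cover_number_anti A d e n :
  d <= e -> coverable A d n -> cover_number A e <= cover_number A d.
Proof.
move=> de Ad; have [m [Am -> _]] := cover_numberP Ad.
exact/cover_number_le/(coverable_le_diam de).
Qed.

Lemma eq_cover_number (W : normedModType R) A (B : set W) d :
  (forall n, coverable A d n <-> coverable B d n) ->
  cover_number A d = cover_number B d.
Proof.
by move=> AB; congr inf; apply/seteqP; split=> _ [n /AB ? <-]; exists n.
Qed.

End CoverNumber.

Definition unit_box (R : realType) : set (R * R) :=
  [set z | forall l, 0 <= axis_proj l z <= 1].

Definition open_unit_box (R : realType) : set (R * R) :=
  [set z | forall l, 0 < axis_proj l z < 1].

Arguments unit_box {R}.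
Arguments open_unit_box {R}.

Section PlaneCover.
Variable R : realType.
Implicit Types (L : set (R * R)) (K : set R) (delta : R).

Lemma axis_proj_map (l : axis) (S : plane_map R) z :
  axis_proj l (map_fun S z) = sim_fun (axis_proj l S) (axis_proj l z).
Proof. by case: l. Qed.

Lemma axis_proj_sub (l : axis) (x y : R * R) :
  axis_proj l (x - y) = axis_proj l x - axis_proj l y.
Proof. by case: l. Qed.

Lemma norm_plane_le (z : R * R) delta :
  (`|z| <= delta) <-> (forall l, `|axis_proj l z| <= delta).
Proof.
rewrite prod_normE ge_max; split=> [/andP[z1 z2] []//|z12].
by rewrite (z12 axis1) (z12 axis2).
Qed.

Lemma sim_fun_sub (f : similarity R) u v :
  sim_fun f u - sim_fun f v = slope f * (u - v).
Proof. by rewrite /sim_fun /slope; ring. Qed.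

Lemma coverable_unit_interval K delta : 0 < delta -> K `<=` `[0, 1] ->
  exists2 n, coverable K delta n & n%:R <= delta^-1 + 2.
Proof.
move=> d0 K01; set n := (Num.trunc (delta^-1)).+1.
exists #|predT : pred 'I_n.+1|; last first.
  have di : 0 <= delta^-1 by rewrite invr_ge0 ltW.
  have /andP[h _] := truncn_itv di.
  by rewrite card_ord /n -[_.+2]addn2 natrD lerD2r.
apply: (@coverable_finType _ _ _ _ _ _
  (fun i : 'I_n.+1 => [set x | i%:R * delta <= x <= i.+1%:R * delta])).
  move=> i x y _ /= /andP[x1 x2] /andP[y1 y2].
  by rewrite ler_norml; move: x2 y2; rewrite -natr1; lra.
move=> x /K01; rewrite /= in_itv/= => /andP[x0 x1].
have xd : 0 <= x / delta by rewrite divr_ge0// ltW.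
have /andP[t1 t2] := truncn_itv xd.
have tn : (Num.trunc (x / delta) < n.+1)%N.
  rewrite ltnS leqW// /n; apply: le_truncn.
  by rewrite ler_piMl// invr_ge0 ltW.
exists (Ordinal tn) => //=; rewrite -ler_pdivlMr// t1/=.
by rewrite -ler_pdivrMr// ltW.
Qed.

Lemma coverable_plane L delta m n :
  coverable (axis_proj axis1 @` L) delta m ->
  coverable (axis_proj axis2 @` L) delta n ->
  coverable L delta (m * n).
Proof.
move=> [U [U1 U2]] [W [W1 W2]].
rewrite -{1}(card_ord m) -{1}(card_ord n) -card_prod.
apply: (@coverable_finType _ _ _ _ _ _
   (fun i : 'I_m * 'I_n => [set z | U i.1 z.1 /\ W i.2 z.2])).
  move=> [i j] x y _ /= [Ux Wx] [Uy Wy]; apply/norm_plane_le => -[]/=.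
    exact: U1 Ux Uy.
  exact: W1 Wx Wy.
move=> z Lz.
have [i _ Uz] : (\bigcup_i U i) z.1 by apply: U2; exists z.
have [j _ Wz] : (\bigcup_i W i) z.2 by apply: W2; exists z.
by exists (i, j).
Qed.

Lemma proj_unit_box L l : L `<=` unit_box -> axis_proj l @` L `<=` `[0, 1].
Proof. by move=> L01 _ [z /L01 /(_ l) Lz <-]; rewrite /= in_itv. Qed.

Lemma coverable_unit_box L delta : 0 < delta -> L `<=` unit_box ->
  exists n, coverable L delta n.
Proof.
move=> d0 L01.
have [m Lm _] := coverable_unit_interval d0 (proj_unit_box (l := axis1) L01).
have [n Ln _] := coverable_unit_interval d0 (proj_unit_box (l := axis2) L01).
by exists (m * n)%N; apply: coverable_plane.
Qed.

End PlaneCover.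

(** * Iterated maps *)

Section Iterates.
Variable R : realType.
Implicit Types (S T : plane_map R) (G H : {fset plane_map R}) (l : axis).
Implicit Types (L : set (R * R)).

Definition ratio l S : R := `|slope (axis_proj l S)|.

Lemma ratio_comp l S T : ratio l (map_comp S T) = ratio l S * ratio l T.
Proof. by case: l; rewrite /ratio /slope normrM. Qed.

Lemma ratio_id l : ratio l (map_id : plane_map R) = 1.
Proof. by case: l; rewrite /ratio /slope normr1. Qed.

Lemma map_compA S T U :
  map_comp S (map_comp T U) = map_comp (map_comp S T) U.
Proof.
by rewrite /map_comp /sim_comp /=; congr pair; congr pair; ring.
Qed.

Lemma map_comp1 S : map_comp S map_id = S.
Proof.
case: S => [[r t] [r' t']]; rewrite /map_comp /sim_comp /=.
by congr pair; congr pair; ring.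
Qed.

Lemma map_1comp S : map_comp map_id S = S.
Proof.
case: S => [[r t] [r' t']]; rewrite /map_comp /sim_comp /=.
by congr pair; congr pair; ring.
Qed.

Lemma map_iterSP G n S : reflect
  (exists2 A, A \in G & exists2 B, B \in map_iter G n & S = map_comp A B)
  (S \in map_iter G n.+1).
Proof. exact: (iffP (imfset2P _ _ _ _ _)). Qed.

Lemma map_iter0 G : map_iter G 0 = [fset map_id]%fset.
Proof. by []. Qed.

Lemma map_iter_add G m n S T :
  S \in map_iter G m -> T \in map_iter G n ->
  map_comp S T \in map_iter G (m + n).
Proof.
elim: m S => [|m IH] S.
  by rewrite map_iter0 inE => /eqP ->; rewrite map_1comp.
move=> /map_iterSP[A AG [B Bm ->]] Tn; rewrite -map_compA addSn.
by apply/map_iterSP; exists A => //; exists (map_comp B T) => //; exact: IH.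
Qed.

Lemma map_iter_split G m n S : S \in map_iter G (m + n) ->
  exists2 A, A \in map_iter G m &
  exists2 B, B \in map_iter G n & S = map_comp A B.
Proof.
elim: m S => [|m IH] S.
  by move=> Sn; exists map_id; [rewrite map_iter0 inE | exists S;
    rewrite ?map_1comp].
rewrite addSn => /map_iterSP[A AG [B /IH[C Cm [D Dn ->]] ->]].
exists (map_comp A C); last by exists D; rewrite ?map_compA.
by apply/map_iterSP; exists A => //; exists C.
Qed.

Lemma map_iter1 G : map_iter G 1 = G.
Proof.
apply/fsetP => S; apply/map_iterSP/idP => [[A AG [B]]|SG].
  by rewrite map_iter0 inE => /eqP -> ->; rewrite map_comp1.
by exists S => //; exists map_id; rewrite ?map_comp1// map_iter0 inE.
Qed.

Lemma axis_proj_comp l S T :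
  axis_proj l (map_comp S T) = sim_comp (axis_proj l S) (axis_proj l T).
Proof. by case: l. Qed.

Lemma sim_iterSP (F : {fset similarity R}) n f : reflect
  (exists2 g, g \in F & exists2 h, h \in sim_iter F n & f = sim_comp g h)
  (f \in sim_iter F n.+1).
Proof. exact: (iffP (imfset2P _ _ _ _ _)). Qed.

Lemma proj_map_iter l G n :
  proj_ifs l (map_iter G n) = sim_iter (proj_ifs l G) n.
Proof.
elim: n => [|n IH].
  apply/fsetP => f; apply/imfsetP/idP => [[S]|].
    by rewrite map_iter0 inE => /eqP -> ->; rewrite inE; case: l.
  rewrite inE => /eqP ->; exists map_id; first by rewrite map_iter0 inE.
  by case: l.
apply/fsetP => f; apply/imfsetP/sim_iterSP.
  move=> [S /map_iterSP[A AG [B Bn ->]] ->]; rewrite axis_proj_comp.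
  exists (axis_proj l A); first by apply/imfsetP; exists A.
  by exists (axis_proj l B) => //; rewrite -IH; apply/imfsetP; exists B.
move=> [_ /imfsetP[A AG ->] [h]]; rewrite -IH => /imfsetP[B Bn ->] ->.
exists (map_comp A B); last by rewrite axis_proj_comp.
by apply/map_iterSP; exists A => //; exists B.
Qed.

(** The ratio bound is [<= 1] so that the identity, the only map of level 0, is included and the
    predicate passes to all iterates. *)
Definition admissible L S := [/\ forall l, 0 < ratio l S <= 1,
  forall z, L z -> L (map_fun S z)
  & forall z, open_unit_box z -> open_unit_box (map_fun S z)].

Lemma admissible_comp L S T :
  admissible L S -> admissible L T -> admissible L (map_comp S T).
Proof.
move=> [S1 S2 S3] [T1 T2 T3]; rewrite /admissible map_fun_comp; split.
- move=> l; have [/andP[? ?] /andP[? ?]] := (S1 l, T1 l).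
  by rewrite ratio_comp mulr_gt0//= mulr_ile1// ltW.
- by move=> z /T2 /S2.
- by move=> z /T3 /S3.
Qed.

Lemma admissible_iter L G n :
  (forall S, S \in G -> admissible L S) ->
  forall S, S \in map_iter G n -> admissible L S.
Proof.
move=> GL; elim: n => [|n IH] S.
  rewrite map_iter0 inE => /eqP ->.
  by rewrite /admissible map_fun_id; split=> // l; rewrite ratio_id ltr01 lexx.
by move=> /map_iterSP[A /GL ? [B /IH ? ->]]; exact: admissible_comp.
Qed.

Definition disjoint_boxes S T := forall z w,
  open_unit_box z -> open_unit_box w -> map_fun S z <> map_fun T w.

Definition separated H := forall S T, S \in H -> T \in H -> S != T ->
  disjoint_boxes S T.

Lemma open_unit_boxE :
  (open_unit_box : set (R * R)) = `]0, 1[ `*` `]0, 1[.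
Proof.
apply/seteqP; split=> [z zP|z /= []].
  by split; rewrite /= in_itv/=; [exact: (zP axis1)|exact: (zP axis2)].
by rewrite !in_itv /= => z1 z2 [].
Qed.

Lemma rectangular_osc_separated G : rectangular_osc G -> separated G.
Proof.
rewrite /rectangular_osc -open_unit_boxE => oscG S T SG TG ST z w zP wP e.
suff: set0 (map_fun S z) by [].
by rewrite -(oscG S T SG TG ST); split; [exists z|rewrite e; exists w].
Qed.

Lemma map_fun_injective S : (forall l, 0 < ratio l S) -> injective (map_fun S).
Proof.
move=> S0 z w e; have zw l : axis_proj l z = axis_proj l w.
  have := congr1 (axis_proj l) e; rewrite !axis_proj_map => /eqP.
  rewrite -subr_eq0 sim_fun_sub mulf_eq0 -normr_eq0 gt_eqF ?S0//=.
  by rewrite subr_eq0 => /eqP.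
by rewrite (surjective_pairing z) (surjective_pairing w);
  have /= -> := zw axis1; have /= -> := zw axis2.
Qed.

Lemma open_unit_box_neq0 : open_unit_box (2^-1, 2^-1 : R).
Proof. by case; rewrite /= invr_gt0 ltr0n invf_lt1 ?ltr0n// ltr1n. Qed.

Lemma disjoint_boxes_irr S : ~ disjoint_boxes S S.
Proof. by move=> /(_ _ _ open_unit_box_neq0 open_unit_box_neq0); apply. Qed.

Section SeparatedIter.
Variables (L : set (R * R)) (G : {fset plane_map R}).
Hypotheses (GL : forall S, S \in G -> admissible L S) (sepG : separated G).

(** If the first maps differ, the two boxes lie inside disjoint boxes; if they agree, that injective
    map cancels. The pairs, not the compositions, are assumed distinct, as counting words
    requires. *)
Lemma disjoint_comp A B C D n : A \in G -> C \in G ->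
  B \in map_iter G n -> D \in map_iter G n ->
  (B != D -> disjoint_boxes B D) ->
  (A, B) != (C, D) -> disjoint_boxes (map_comp A B) (map_comp C D).
Proof.
move=> AG CG Bn Dn BD ne z w zP wP; rewrite !map_fun_comp /=.
have [_ _ Bo] := admissible_iter GL Bn.
have [_ _ Do] := admissible_iter GL Dn.
have [AC|AC] := eqVneq A C; last first.
  by apply: (sepG AG CG AC); [exact: Bo|exact: Do].
move: ne; rewrite AC xpair_eqE eqxx /= => {}/BD BD.
have [C0 _ _] := GL CG.
move=> /map_fun_injective e; apply: (BD _ _ zP wP); apply: e => l.
by have /andP[] := C0 l.
Qed.

Lemma separated_iter n : separated (map_iter G n).
Proof.
elim: n => [|n IH] S T.
  by rewrite map_iter0 !inE => /eqP -> /eqP ->; rewrite eqxx.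
move=> /map_iterSP[A AG [B Bn ->]] /map_iterSP[C CG [D Dn ->]] ne.
apply: (disjoint_comp AG CG Bn Dn); first exact: (IH B D Bn Dn).
by apply: contra_neq ne => -[-> ->].
Qed.

(** Distinct words have disjoint boxes, and no box is disjoint from itself, so no two words collapse
    to the same map. *)
Lemma card_separated_iter n : #|` map_iter G n| = (#|` G| ^ n)%N.
Proof.
elim: n => [|n IH]; first by rewrite map_iter0 cardfs1.
have IHsep := @separated_iter n.
rewrite card_fset_sum1 /map_iter iterS -/(map_iter G n) big_imfset2/=.
  rewrite (eq_bigr (fun=> 1 * #|` G| ^ n)%N); last first.
    by move=> A _; rewrite -card_fset_sum1 IH mul1n.
  by rewrite -big_distrl/= -card_fset_sum1 expnS.
move=> [A B] [C D]; rewrite !inE/= => /andP[AG Bn] /andP[CG Dn] e.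
apply/eqP/negPn/negP => neS.
have ne : (A, B) != (C, D) by apply: contra_neq neS => -[-> ->].
have := disjoint_comp AG CG Bn Dn (IHsep B D Bn Dn) ne.
by rewrite /= in e; rewrite e; exact: disjoint_boxes_irr.
Qed.

End SeparatedIter.

Lemma sum_subset_le (T : eqType) (s1 s2 : seq T) (F : T -> R) :
  (forall x, 0 <= F x) -> uniq s1 -> {subset s1 <= s2} ->
  \sum_(x <- s1) F x <= \sum_(x <- s2) F x.
Proof.
move=> F0; elim: s1 s2 => [|x s1 IH] s2 /=.
  by move=> _ _; rewrite big_nil sumr_ge0.
move=> /andP[xs1 s1u] s12; have xs2 : x \in s2 by apply: s12; rewrite mem_head.
rewrite (perm_big _ (perm_to_rem xs2)) !big_cons lerD2l IH// => y ys1.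
have := s12 y; rewrite inE ys1 orbT (perm_mem (perm_to_rem xs2)) inE.
by move=> /(_ isT)/predU1P[yx|//]; move: xs1; rewrite -yx ys1.
Qed.

(** Only an inequality, because [map_iter] is a set: different pairs may have the same composition,
    which is counted once on the left. *)
Lemma sum_map_iter_add G m n (w : plane_map R -> R) :
  (forall S, 0 <= w S) ->
  (forall S T, w (map_comp S T) = w S * w T) ->
  \sum_(S <- map_iter G (m + n)) w S <=
  (\sum_(S <- map_iter G m) w S) * (\sum_(S <- map_iter G n) w S).
Proof.
move=> w0 wM.
apply: (@le_trans _ _ (\sum_(S <- [seq map_comp A B | A <- map_iter G m,
    B <- map_iter G n]) w S)).
  apply: sum_subset_le => // S /map_iter_split[A Am [B Bn ->]].
  by apply/allpairsP; exists (A, B).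
rewrite big_allpairs_dep big_distrl /=; apply: ler_sum => S _.
by rewrite big_distrr/= ler_sum// => T _; rewrite wM.
Qed.

End Iterates.

(** * Growth and one-sided dimension bounds *)

Section Growth.
Variable R : realType.
Implicit Types (b q r X : R).

Lemma geometric_small b e : 0 < b < 1 -> 0 < e ->
  exists k0, forall k, (k0 <= k)%N -> b ^+ k <= e.
Proof.
move=> /andP[b0 b1] e0; have b1' : `|b| < 1 by rewrite gtr0_norm.
have /cvgrPdist_le /(_ _ e0) [k0 _ H] := cvg_expr b1'.
exists k0 => k kk0; have := H k kk0.
by rewrite /= sub0r normrN ger0_norm// exprn_ge0// ltW.
Qed.

Lemma geometric_large q X : 1 < q ->
  exists k0, forall k, (k0 <= k)%N -> X <= q ^+ k.
Proof.
move=> q1; have q0 : 0 < q by exact: lt_trans q1.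
have X0 : 0 < `|X| + 1 by rewrite ltr_wpDl.
have [||k0 H] := @geometric_small q^-1 (`|X| + 1)^-1.
- by rewrite invr_gt0 q0 invf_lt1.
- by rewrite invr_gt0.
exists k0 => k /H; rewrite exprVn lef_pV2 ?posrE ?exprn_gt0//.
by apply: le_trans; rewrite (le_trans (ler_norm _))// lerDl.
Qed.

Lemma geometric_scale b d k0 : 0 < b < 1 -> 0 < d < b ^+ k0 ->
  exists2 k, (k0 <= k)%N & b ^+ k.+1 <= d <= b ^+ k.
Proof.
move=> b01 /andP[d0 dk0]; have [k1 /(_ _ (leqnn _)) Hk1] :=
  geometric_small b01 d0.
have ex : exists k, b ^+ k <= d by exists k1.
have /andP[b0 b1] := b01.
have [k kd kmin] := ex_minnP ex; have k0k : (k0 < k)%N.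
  rewrite ltnNge; apply/negP => kk0.
  have bk : b ^+ k0 <= b ^+ k by rewrite ler_wiXn2l// ltW.
  by have := lt_le_trans dk0 (le_trans bk kd); rewrite ltxx.
case: k k0k kd kmin => // k k0k kd kmin; exists k => //; rewrite kd/=.
by rewrite leNgt; apply/negP => /ltW /kmin; rewrite ltnn.
Qed.

Lemma exists_powR_lt r X : 0 < r -> 1 < X -> exists2 e, 0 < e & r `^ e < X.
Proof.
move=> r0 X1; have X0 : 0 < X by exact: lt_trans X1.
have lX : 0 < ln X by rewrite ln_gt0.
exists (ln X / (`|ln r| + 1)); first by rewrite divr_gt0// ltr_wpDl.
rewrite -[ltRHS]lnK ?posrE// /powR gt_eqF// ltr_expR mulrAC.
rewrite ltr_pdivrMr ?ltr_wpDl// ltr_pM2l//.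
by rewrite (le_lt_trans (ler_norm _))// ltrDl.
Qed.

Lemma powR_anti r x y : 0 < r <= 1 -> y <= x -> r `^ x <= r `^ y.
Proof. by move=> r1; exact: ger_powR. Qed.

Lemma powR_expn r x n : 0 <= r -> (r ^+ n) `^ x = (r `^ x) ^+ n.
Proof.
by move=> r0; rewrite -(powR_mulrn n r0) -(powR_mulrn n (powR_ge0 r x)) powRAC.
Qed.

Lemma powRVN r x : 0 < r -> r^-1 `^ (- x) = r `^ x.
Proof. by move=> r0; rewrite -powR_inv1 ?ltW// -powRrM mulN1r opprK. Qed.

Lemma powR_neg_gt1 b x : 0 < b < 1 -> 0 < x -> 1 < b `^ (- x).
Proof.
move=> /andP[b0 b1] x0; rewrite powRN invf_gt1 ?powR_gt0//.
have := gt0_ltr_powR x0 (x := b) (y := 1).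
by rewrite powR1; apply; rewrite ?nnegrE// ltW.
Qed.

End Growth.

Section PolynomialGrowth.
Variable R : realType.
Implicit Types (q C : R).

Lemma bernoulli_ge (x : R) k : 0 <= x -> 1 + k%:R * x <= (1 + x) ^+ k.
Proof.
move=> x0; elim: k => [|k IH]; first by rewrite mul0r addr0 expr0.
rewrite exprS; apply: (@le_trans _ _ ((1 + x) * (1 + k%:R * x))).
  have : 0 <= k%:R * x * x by rewrite !mulr_ge0.
  by rewrite -natr1; lra.
by rewrite ler_wpM2l// addr_ge0.
Qed.

(** Write q = r * r. Bernoulli bounds one factor [r ^+ k] below by 1 + k (r - 1), and the other is
    eventually at least 1 + 1 / (r - 1); the product of these bounds is at least k + 1. *)
Lemma linear_le_geometric q : 1 < q ->
  exists k0, forall k, (k0 <= k)%N -> k.+1%:R <= q ^+ k.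
Proof.
move=> q1; have q0 : 0 <= q by rewrite ltW// (lt_trans _ q1).
set r := Num.sqrt q.
have r1 : 1 < r by rewrite -sqrtr1 ltr_sqrt// (lt_trans _ q1).
have r0 : 0 < r := lt_trans ltr01 r1.
have [k0 Hk0] := geometric_large (1 + (r - 1)^-1) r1.
exists k0 => k /Hk0 h.
have -> : q = r * r by rewrite -expr2 sqr_sqrtr.
have rm0 : 0 < r - 1 by rewrite subr_gt0.
have := @bernoulli_ge (r - 1) k (ltW rm0);
  (have -> : 1 + (r - 1) = r by ring) => b.
rewrite exprMn; apply: le_trans (ler_wpM2r _ h);
  last by rewrite exprn_ge0// ltW.
apply: le_trans (ler_wpM2l _ b); last by rewrite addr_ge0// invr_ge0 ltW.
have -> : (1 + (r - 1)^-1) * (1 + k%:R * (r - 1)) =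
    k%:R + 1 + k%:R * (r - 1) + (r - 1)^-1 by field; rewrite gt_eqF.
rewrite natr1 -addrA lerDl addr_ge0 ?invr_ge0 ?(ltW rm0)//.
by rewrite mulr_ge0// ltW.
Qed.

Lemma polynomial_le_geometric q C n : 1 < q ->
  exists k0, forall k, (k0 <= k)%N -> C * k.+1%:R ^+ n <= q ^+ k.
Proof.
elim: n q => [|n IH] q q1.
  by have [k0 H] := geometric_large C q1; exists k0 => k /H;
    rewrite expr0 mulr1.
have q0 : 0 <= q by rewrite ltW// (lt_trans _ q1).
set r := Num.sqrt q.
have r1 : 1 < r by rewrite -sqrtr1 ltr_sqrt// (lt_trans _ q1).
have r0 : 0 <= r := ltW (lt_trans ltr01 r1).
have [k0 H0] := IH r r1; have [k1 H1] := linear_le_geometric r1.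
exists (maxn k0 k1) => k; rewrite geq_max => /andP[/H0 h0 /H1 h1].
have -> : q = r * r by rewrite -expr2 sqr_sqrtr.
rewrite exprMn exprSr mulrA; apply: (@le_trans _ _ (r ^+ k * k.+1%:R)).
  by rewrite ler_wpM2r.
by rewrite ler_wpM2l// exprn_ge0.
Qed.

Lemma eventually_scales b k0 (P : R -> Prop) : 0 < b < 1 ->
  (forall k d, (k0 <= k)%N -> 0 < d -> b ^+ k.+1 <= d <= b ^+ k -> P d) ->
  exists2 e, 0 < e < 1 & forall d, 0 < d <= e -> P d.
Proof.
move=> b01 HP; have /andP[b0 b1] := b01.
have bk0 : 0 < b ^+ k0 by rewrite exprn_gt0.
exists (b ^+ k0 / 2).
  rewrite divr_gt0//= ltr_pdivrMr// mul1r (@le_lt_trans _ _ 1) ?ltr1n//.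
  by rewrite exprn_ile1// ltW.
move=> d /andP[d0 dk0]; have [|k k0k bkd] := @geometric_scale _ b d k0 b01.
  by rewrite d0 (le_lt_trans dk0)// ltr_pdivrMr// ltr_pMr ?ltr1n.
exact: HP bkd.
Qed.

Lemma seq_positive_bound (T : eqType) (E : seq T) (f : T -> R) :
  (forall x, x \in E -> 0 < f x) ->
  exists2 p, 0 < p < 1 & forall x, x \in E -> p <= f x.
Proof.
elim: E => [|x E IH] fE.
  by exists (2^-1) => //; rewrite invr_gt0 ltr0n invf_lt1 ?ltr0n// ltr1n.
have [|p /andP[p0 p1] pE] := IH.
  by move=> y yE; apply: fE; rewrite inE yE orbT.
have fx := fE x (mem_head _ _).
exists (Num.min p (f x)); first by rewrite lt_min p0 fx gt_min p1.
move=> y; rewrite inE => /predU1P[->|/pE py]; first by rewrite ge_min lexx orbT.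
by rewrite ge_min py.
Qed.

Lemma powRD_gt0 (u x y : R) : 0 < u -> u `^ (x + y) = u `^ x * u `^ y.
Proof. by move=> u0; rewrite powRD// (gt_eqF u0) implybT. Qed.

(** The absolute value treats both signs of the exponent at once. In use, [u] is the short side of a
    stopped box divided by the scale. *)
Lemma powR_ge_abs (p u x : R) : 0 < p <= u -> u <= 1 -> p `^ `|x| <= u `^ x.
Proof.
move=> /andP[p0 pu] u1; have u0 : 0 < u := lt_le_trans p0 pu.
apply: (@le_trans _ _ (u `^ `|x|)).
  by apply: ge0_ler_powR; rewrite ?nnegrE// ltW.
by apply: powR_anti; rewrite ?u0// ler_norm.
Qed.

Lemma powR_le_abs (p u x : R) : 0 < p <= u -> u <= 1 -> u `^ x <= p `^ (- `|x|).
Proof.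
move=> pu u1; have /andP[p0 pu'] := pu.
rewrite -[x]opprK powRN [leRHS]powRN lef_pV2 ?posrE ?powR_gt0//; last first.
  exact: lt_le_trans pu'.
by rewrite opprK -[in `|x|]normrN powR_ge_abs.
Qed.

End PolynomialGrowth.

Section Bounds.
Variables (R : realType) (V : normedModType R).
Implicit Types (A : set V) (s d : R).

(** The constant is 1: dimensions are read off from all exponents on one side of a value, so an
    arbitrarily small change of [s] absorbs a constant factor. *)
Definition cover_ubd A s :=
  \forall d \near 0^'+, cover_number A d <= d `^ (- s).

Definition cover_lbd A s :=
  \forall d \near 0^'+, d `^ (- s) <= cover_number A d.

Definition coverable_scales A := forall d, 0 < d -> exists n, coverable A d n.

Lemma near0P (P : R -> Prop) :
  (\forall d \near 0^'+, P d) <-> exists2 e, 0 < e < 1 & forall d,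
    0 < d <= e -> P d.
Proof.
split=> [[e /= e0 H]|[e /andP[e0 e1] H]].
  have m0 : 0 < Num.min (e / 2) 2^-1 by rewrite lt_min invr_gt0 ltr0n divr_gt0.
  exists (Num.min (e / 2) 2^-1).
    by rewrite m0 gt_min invf_lt1 ?ltr0n// ltr1n orbT.
  move=> d /andP[d0]; rewrite le_min => /andP[de _]; apply: H => //=.
  rewrite sub0r normrN gtr0_norm// (le_lt_trans de)//.
  by rewrite ltr_pdivrMr// ltr_pMr// ltr1n.
exists e => //= d /=; rewrite sub0r normrN => de d0; apply: H.
by rewrite d0 ltW//; move: de; rewrite gtr0_norm.
Qed.

Lemma cover_ubdP A s : cover_ubd A s <->
  exists2 e, 0 < e < 1 & forall d, 0 < d <= e -> cover_number A d <= d `^ (- s).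
Proof. exact: near0P. Qed.

Lemma cover_lbdP A s : cover_lbd A s <->
  exists2 e, 0 < e < 1 & forall d, 0 < d <= e -> d `^ (- s) <= cover_number A d.
Proof. exact: near0P. Qed.

Lemma cover_lbd_le A s s' : s' <= s -> cover_lbd A s -> cover_lbd A s'.
Proof.
move=> ss' /near0P[e e01 H]; apply/near0P;
  exists e => // d /[dup]/andP[d0 de] /H.
apply: le_trans; apply: powR_anti; last by rewrite lerN2.
by case/andP: e01 => e0 e1; rewrite d0 (le_trans de)// ltW.
Qed.

Lemma cover_ubd_lbd_le A s s' : cover_ubd A s -> cover_lbd A s' -> s' <= s.
Proof.
move=> /near0P[e /andP[e0 e1] H] /near0P[f /andP[f0 f1] H'].
set d := Num.min e f; have d0 : 0 < d by rewrite lt_min e0.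
have d1 : d < 1 by rewrite gt_min e1.
have {}H : cover_number A d <= d `^ (- s) by apply: H; rewrite d0 ge_min lexx.
have {}H' : d `^ (- s') <= cover_number A d.
  by apply: H'; rewrite d0 ge_min lexx orbT.
have := le_trans H' H; rewrite /powR gt_eqF// ler_expR !mulNr lerN2.
by rewrite ler_nM2r// ln_lt0// d0.
Qed.

Lemma cover_lbd_nonpos A s : A !=set0 -> coverable_scales A -> s <= 0 ->
  cover_lbd A s.
Proof.
move=> A0 Ac s0; apply/near0P; exists (2^-1).
  by rewrite invr_gt0 ltr0n invf_lt1 ?ltr0n// ltr1n.
move=> d /andP[d0 d2]; have [n An] := Ac d d0.
apply: le_trans (cover_number_ge1 A0 An); rewrite -(powRr0 d) powR_anti//.
  by rewrite d0 (le_trans d2)// invf_le1// ler1n.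
by rewrite oppr_ge0.
Qed.

(** On scales between [e] and 1 the covering number is at least 1, while [d ^ (-s)] is at most
    [e ^ (-s)] or 1 according to the sign of [s]. *)
Lemma cover_lbd_unif A s : A !=set0 -> coverable_scales A -> cover_lbd A s ->
  exists2 c, 0 < c & forall d, 0 < d <= 1 -> c * d `^ (- s) <= cover_number A d.
Proof.
move=> A0 Ac /near0P[e /andP[e0 e1] H].
exists (Num.min 1 (e `^ s)); first by rewrite lt_min ltr01 powR_gt0.
move=> d /andP[d0 d1]; have [de|ed] := leP d e.
  apply: (@le_trans _ _ (d `^ (- s))); last by apply: H; rewrite d0.
  by rewrite ler_piMl ?powR_ge0// ge_min lexx.
have [n An] := Ac d d0; apply: le_trans (cover_number_ge1 A0 An).
have [s0|s0] := leP 0 s.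
  apply: (@le_trans _ _ (e `^ s * d `^ (- s))).
    by rewrite ler_wpM2r ?powR_ge0// ge_min lexx orbT.
  rewrite powRN ler_pdivrMr ?powR_gt0// mul1r.
  by apply: ge0_ler_powR; rewrite ?nnegrE// ltW.
apply: (@le_trans _ _ (1 * d `^ (- s))).
  by rewrite ler_wpM2r ?powR_ge0// ge_min lexx.
by rewrite mul1r -(powRr0 d) powR_anti// ?d0// oppr_ge0 ltW.
Qed.

(** The range up to [X] matters because scales rescaled by a stopped map can exceed 1. Beyond [e]
    the covering number is at most its value at [e], which goes into the constant. *)
Lemma cover_ubd_unif A s : A !=set0 -> coverable_scales A -> cover_ubd A s ->
  forall X, exists2 C, 0 < C &
    forall d, 0 < d <= X -> cover_number A d <= C * d `^ (- s).
Proof.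
move=> A0 Ac /near0P[e /andP[e0 e1] H] X.
have [n Ae] := Ac e e0.
have NA : 1 <= cover_number A e := cover_number_ge1 A0 Ae.
set C := cover_number A e * (e `^ s + (e + `|X|) `^ s).
have C0 : 0 < C.
  by rewrite mulr_gt0 ?(lt_le_trans _ NA)// ltr_pwDl ?powR_gt0 ?powR_ge0.
exists (1 + C); first by rewrite addr_gt0.
move=> d /andP[d0 dX]; have [de|ed] := leP d e.
  apply: (@le_trans _ _ (d `^ (- s))); first by apply: H; rewrite d0.
  by rewrite ler_peMl ?powR_ge0// lerDl ltW.
apply: (@le_trans _ _ (C * d `^ (- s))); last first.
  by rewrite ler_wpM2r ?powR_ge0// lerDr.
apply: (le_trans (cover_number_anti (ltW ed) Ae)).
rewrite /C -mulrA ler_peMr ?(le_trans _ NA)// powRN -/(_ / _).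
rewrite ler_pdivlMr ?powR_gt0// mul1r.
have [s0|s0] := leP 0 s.
  apply: (@le_trans _ _ ((e + `|X|) `^ s)); last by rewrite lerDr powR_ge0.
  have eX : 0 < e + `|X| by rewrite ltr_pwDl.
  have dX' : d <= e + `|X|.
    by rewrite (le_trans dX)// (le_trans (ler_norm _))// lerDr ltW.
  by apply: ge0_ler_powR; rewrite ?nnegrE// ltW.
apply: (@le_trans _ _ (e `^ s)); last by rewrite lerDl powR_ge0.
rewrite -[s]opprK powRN [leRHS]powRN lef_pV2 ?posrE ?powR_gt0//.
by apply: ge0_ler_powR; rewrite ?nnegrE// ?oppr_ge0// ltW.
Qed.

End Bounds.

(** * Disjoint boxes meeting a small square *)

Section Overlap.
Variable R : realType.
Implicit Types (S T : plane_map R) (H : {fset plane_map R}) (l : axis).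
Implicit Types (L : set (R * R)) (d : R).

Lemma subinterval_image (f : similarity R) d z : 0 < d -> d <= `|slope f| ->
  0 <= z <= 1 -> exists2 c, c <= sim_fun f z <= c + d &
    forall w, c < w < c + d -> exists2 y, 0 < y < 1 & sim_fun f y = w.
Proof.
case: f => r t; rewrite /slope /sim_fun /= => d0 dr /andP[z0 z1].
have r_neq0 : r != 0 by rewrite -normr_gt0 (lt_le_trans d0).
have solve w : (if 0 < r then t < w < t + r else t + r < w < t) ->
    exists2 y, 0 < y < 1 & r * y + t = w.
  move=> wP; exists ((w - t) / r); last by field.
  move: r_neq0 wP; case: (ltgtP r 0) => // r0 _ /andP[w1 w2].
    apply/andP; split; first by rewrite ltr_ndivlMr//; lra.
    by rewrite ltr_ndivrMr//; lra.
  apply/andP; split; first by rewrite ltr_pdivlMr//; lra.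
  by rewrite ltr_pdivrMr//; lra.
move: solve dr r_neq0; case: (ltgtP r 0) => // r0 solve dr _.
  rewrite ltr0_norm// in dr.
  have rz : r <= r * z <= 0.
    by rewrite nmulr_rle0// z0 andbT -[leLHS]mulr1 ler_nM2l.
  (* The window of length [d] starts at the image of [z] unless it would then pass the right end of
     the interval, here [t]; in that case it is pushed back to end there. For positive slope the
     right end is [t + r]. *)
  exists (Num.min (r * z + t) (t - d)).
    by rewrite ge_min lexx/= -lerBlDr le_min; apply/andP; split; lra.
  move=> w /andP[]; rewrite gt_min -ltrBlDr lt_min => w1 /andP[w2 w3].
  by apply: solve; apply/andP; split; case/orP: w1; lra.
rewrite gtr0_norm// in dr.
have rz : 0 <= r * z <= r.
  by rewrite mulr_ge0//= ?ler_piMr// ltW.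
exists (Num.min (r * z + t) (t + r - d)).
  by rewrite ge_min lexx/= -lerBlDr le_min; apply/andP; split; lra.
move=> w /andP[]; rewrite gt_min -ltrBlDr lt_min => w1 /andP[w2 w3].
by apply: solve; apply/andP; split; case/orP: w1; lra.
Qed.

Lemma open_boxes_meet S T d (c c' : axis -> R) : 0 < d ->
  (forall l w, c l < w < c l + d ->
    exists2 y, 0 < y < 1 & sim_fun (axis_proj l S) y = w) ->
  (forall l w, c' l < w < c' l + d ->
    exists2 y, 0 < y < 1 & sim_fun (axis_proj l T) y = w) ->
  (forall l, `|c l - c' l| < d) -> ~ disjoint_boxes S T.
Proof.
move=> d0 cS cT cc dST.
(* The midpoint of the overlap of the two windows on axis [l]. *)
pose w l := (c l + c' l + d) / 2.
have wS l : exists2 y, 0 < y < 1 & sim_fun (axis_proj l S) y = w l.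
  by apply: cS; have := cc l; rewrite ltr_norml /w => /andP[]; lra.
have wT l : exists2 y, 0 < y < 1 & sim_fun (axis_proj l T) y = w l.
  by apply: cT; have := cc l; rewrite ltr_norml /w => /andP[]; lra.
have [y1 y1P e1] := wS axis1; have [y2 y2P e2] := wS axis2.
have [x1 x1P f1] := wT axis1; have [x2 x2P f2] := wT axis2.
apply: (dST (y1, y2) (x1, x2)); [by case|by case|].
by congr pair; [exact: etrans e1 (esym f1)|exact: etrans e2 (esym f2)].
Qed.

Lemma trunc_lt4 d x : 0 < d -> 0 <= x <= 3 * d -> (Num.trunc (x / d) < 4)%N.
Proof.
move=> d0 /andP[x0 x3]; have xd : 0 <= x / d by rewrite divr_ge0// ltW.
have /andP[t1 _] := truncn_itv xd.
by rewrite ltnS -(ler_nat R) (le_trans t1)// ler_pdivrMr.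
Qed.

Lemma same_trunc d x y : 0 < d -> 0 <= x -> 0 <= y ->
  Num.trunc (x / d) = Num.trunc (y / d) -> `|x - y| < d.
Proof.
move=> d0 x0 y0 e.
have /andP[] := @truncn_itv _ (x / d) (divr_ge0 x0 (ltW d0)).
have /andP[] := @truncn_itv _ (y / d) (divr_ge0 y0 (ltW d0)).
rewrite -e !ler_pdivlMr// !ltr_pdivrMr// -natr1 mulrDl mul1r ltr_norml.
by move=> h1 h2 h3 h4; apply/andP; split; lra.
Qed.

(* Around its point in [U], each box contains a [d]-square with corner within
   [2 d] of [U]; the [d]-squares are disjoint, so their corners fall in
   different cells of a 4 x 4 grid of mesh [d]. *)
Lemma overlap_le16 H d (U : set (R * R)) : 0 < d -> separated H ->
  (forall S l, S \in H -> d <= ratio l S) ->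
  (forall x y, U x -> U y -> `|x - y| <= d) ->
  (forall S, S \in H -> exists2 z, unit_box z & U (map_fun S z)) ->
  (#|` H| <= 16)%N.
Proof.
move=> d0 sepH dH Ud HU.
have [->|/fset0Pn[S0 S0H]] := eqVneq H fset0; first by rewrite cardfs0.
have [z0 _ Uu] := HU S0 S0H; set u := map_fun S0 z0 in Uu.
have cex (p : H * axis) : exists c : R,
    [/\ axis_proj p.2 u - 2 * d <= c <= axis_proj p.2 u + d
      & forall w, c < w < c + d ->
          exists2 y, 0 < y < 1 & sim_fun (axis_proj p.2 (val p.1)) y = w].
  case: p => [[S SH] l] /=; have [z zP Uz] := HU S SH.
  have [c cz cw] := subinterval_image d0 (dH S l SH) (zP l).
  exists c; split=> //; move: cz; rewrite -axis_proj_map.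
  have /norm_plane_le/(_ l) := Ud _ _ Uz Uu; rewrite axis_proj_sub ler_norml.
  by move=> /andP[h1 h2] /andP[h3 h4]; apply/andP; split; lra.
have [c cP] := choice cex.
pose v (S : H) l := c (S, l) - (axis_proj l u - 2 * d).
have v0 (S : H) l : 0 <= v S l <= 3 * d.
  have [/= /andP[h1 h2] _] := cP (S, l).
  by rewrite /v; apply/andP; split; lra.
pose g (S : H) : 'I_4 * 'I_4 :=
  (Ordinal (trunc_lt4 d0 (v0 S axis1)), Ordinal (trunc_lt4 d0 (v0 S axis2))).
have ginj : injective g.
  move=> S T [/= e1 e2]; apply/eqP/negPn/negP => ST.
  have /= := @open_boxes_meet (val S) (val T) d
    (fun l => c (S, l)) (fun l => c (T, l)) d0; apply.
  - by move=> l w; have [_] := cP (S, l); apply.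
  - by move=> l w; have [_] := cP (T, l); apply.
  - move=> l; have -> : c (S, l) - c (T, l) = v S l - v T l by rewrite /v; ring.
    have [/andP[vS _] /andP[vT _]] := (v0 S l, v0 T l).
    by apply: same_trunc => //; case: (l).
  - by apply: sepH; rewrite ?fsvalP.
rewrite cardfE; have := leq_card g ginj.
by rewrite card_prod !card_ord.
Qed.

(** Double counting of the pairs (S, i) for which the i-th covering set meets S(L). For fixed S,
    pulling these sets back by S and projecting covers p_l L at scale [d / rho], so there are at
    least [m] of them; a fixed set meets at most 16 boxes. *)
Lemma separated_cover L H l d rho m n : L `<=` unit_box -> 0 < d ->
  0 < rho ->
  (forall S, S \in H -> admissible L S) -> separated H ->
  (forall S k, S \in H -> d <= ratio k S) ->
  (forall S, S \in H -> ratio l S = rho) ->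
  (forall k, coverable (axis_proj l @` L) (d / rho) k -> (m <= k)%N) ->
  coverable L d n -> (#|` H| * m <= 16 * n)%N.
Proof.
move=> L01 d0 rho0 HL sepH dH Hrho mP [U [U1 U2]].
pose b S (i : 'I_n) := `[< exists2 z, L z & U i (map_fun S z) >].
have mb S : S \in H -> (m <= \sum_(i < n) b S i)%N.
  move=> SH; have [_ LS _] := HL S SH.
  have -> : (\sum_(i < n) b S i = #|[pred i | b S i]|)%N.
    by rewrite -sum1_card [RHS]big_mkcond; apply: eq_bigr => i _; rewrite inE;
      case: (b S i).
  apply: mP; apply: (@coverable_finType _ _ _ _ _ _
    (fun i => axis_proj l @` [set z | L z /\ U i (map_fun S z)])).
    move=> i x y _ [z [_ Uz] <-] [w [_ Uw] <-].
    have /norm_plane_le/(_ l) := U1 _ _ _ Uz Uw.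
    rewrite axis_proj_sub !axis_proj_map sim_fun_sub normrM.
    by rewrite -/(ratio l S) Hrho// ler_pdivlMr// mulrC.
  move=> _ [z Lz <-]; have [i _ Ui] := U2 _ (LS _ Lz).
  exists i; first by apply/asboolP; exists z.
  by exists z.
apply: (@leq_trans (\sum_(S <- H) \sum_(i < n) b S i)).
  rewrite card_fset_sum1 big_distrl/= big_seq [leqRHS]big_seq leq_sum// => S SH.
  by rewrite mul1n mb.
rewrite exchange_big/= mulnC -[n in leqRHS]card_ord -sum_nat_const leq_sum//
  => i _.
have -> : (\sum_(S <- H) b S i = #|` [fset S in H | b S i]%fset|)%N.
  rewrite card_fset_sum1 [RHS]big_fset [RHS]big_mkcond.
  by apply: eq_bigr => S _; case: (b S i).
apply: (@overlap_le16 _ d (U i)) => //.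
- by move=> S T; rewrite !inE/= => /andP[SH _] /andP[TH _]; exact: sepH.
- by move=> S k; rewrite !inE/= => /andP[SH _]; exact: dH.
- exact: U1.
- by move=> S; rewrite !inE/= => /andP[SH /asboolP[z /L01 zb Uz]]; exists z.
Qed.

End Overlap.

(** * Lower bounds from separated families *)

Section SeparatedFamily.
Variable R : realType.
Implicit Types (L : set (R * R)) (H : {fset plane_map R}) (l : axis).

Lemma axis_cases l (P : axis -> Prop) : P l -> P (other l) -> forall j, P j.
Proof. by case: l => ? ? []. Qed.

Lemma ratio_iter H l a n :
  (forall S, S \in H -> ratio l S = a) ->
  forall S, S \in map_iter H n -> ratio l S = a ^+ n.
Proof.
move=> Ha; elim: n => [|n IH] S.
  by rewrite map_iter0 inE => /eqP ->; rewrite ratio_id.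
by move=> /map_iterSP[A AH [B Bn ->]]; rewrite ratio_comp Ha// IH// exprS.
Qed.

Lemma scales_unit_box L : L `<=` unit_box -> coverable_scales L.
Proof. by move=> L01 d d0; exact: coverable_unit_box. Qed.

Lemma scales_proj L l :
  L `<=` unit_box -> coverable_scales (axis_proj l @` L).
Proof.
move=> L01 d d0; have L01' := proj_unit_box (l := l) L01.
by have [n Ln _] := coverable_unit_interval d0 L01'; exists n.
Qed.

Lemma image_neq0 (T U : Type) (A : set T) (f : T -> U) :
  A !=set0 -> f @` A !=set0.
Proof. by move=> [x Ax]; exists (f x), x. Qed.

(* The [#|H| ^ k] boxes of the [k]-fold compositions are disjoint with short
   side [b ^ k], and each contains a copy of [L] whose long projection is
   [p_l L] scaled by [a l ^ k]. *)
Lemma separated_cover_lbd L H (a : axis -> R) l t s :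
  L !=set0 -> L `<=` unit_box ->
  (forall S, S \in H -> admissible L S) -> separated H ->
  (forall S k, S \in H -> ratio k S = a k) ->
  0 < a (other l) < 1 -> a (other l) <= a l ->
  (forall t', t' < t -> cover_lbd (axis_proj l @` L) t') ->
  1 < #|` H|%:R * ((a l / a (other l)) `^ t * a (other l) `^ s) ->
  cover_lbd L s.
Proof.
move=> L0 L01 HL sepH Ha; set b := a (other l); set M : R := #|` H|%:R.
set r := a l / b => b01 ba Lt.
have /andP[b0 b1] := b01; have al0 : 0 < a l by rewrite (lt_le_trans b0).
have r1 : 1 <= r by rewrite ler_pdivlMr// mul1r.
have r0 : 0 < r by rewrite divr_gt0.
have Lc := scales_unit_box L01; have pc := @scales_proj L l L01.
have [s0 _|s0] := leP s 0; first exact: cover_lbd_nonpos.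
(* Bounds for p_l L are available only below [t]. The strict inequality leaves room to lower [t] by
   some [e] while the growth factor [q] stays above 1. *)
move=> /(exists_powR_lt r0)[e e0 re].
have te : t - e < t by rewrite ltrBlDr ltrDl.
set q := M * (r `^ (t - e) * b `^ s); have q1 : 1 < q.
  rewrite /q powRB ?(gt_eqF r0) ?implybT// mulrAC mulrA.
  by rewrite ltr_pdivlMr ?powR_gt0// mul1r.
have [c c0 cP] := cover_lbd_unif (image_neq0 (axis_proj l) L0) pc (Lt _ te).
have lower k : c * q ^+ k * (b ^+ k) `^ (- s) <= 16 * cover_number L (b ^+ k).
  have bk0 : 0 < b ^+ k by rewrite exprn_gt0.
  have ak0 : 0 < a l ^+ k by rewrite exprn_gt0.
  have eta0 : 0 < b ^+ k / a l ^+ k by rewrite divr_gt0.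
  have eta1 : b ^+ k / a l ^+ k <= 1.
    by rewrite ler_pdivrMr// mul1r lerXn2r// nnegrE ltW.
  have [n' Ln'] := Lc _ bk0; have [n [Ln -> _]] := cover_numberP Ln'.
  have [m' pm'] := pc _ eta0; have [m [_ pm mP]] := cover_numberP pm'.
  have := cP (b ^+ k / a l ^+ k); rewrite eta0 eta1 pm => /(_ isT) cm.
  have := @separated_cover R L (map_iter H k) l _ _ m n L01 bk0 ak0
    (admissible_iter HL (n := k)) (separated_iter HL sepH (n := k)).
  rewrite (card_separated_iter HL sepH).
  move=> /(_ _ _ mP Ln) h.
  have {h} : (#|` H| ^ k * m <= 16 * n)%N.
    apply: h; last by move=> S Sk; rewrite (ratio_iter (fun T => Ha T l) Sk).
    move=> S j Sk; rewrite (ratio_iter (fun T => Ha T j) Sk).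
    have baj : b <= a j by apply: (@axis_cases l (fun j => b <= a j)) ba _ j.
    by rewrite lerXn2r// nnegrE ltW// (lt_le_trans b0 baj).
  rewrite -(ler_nat R) !natrM natrX -/M => h.
  apply: le_trans h; apply: le_trans (ler_wpM2l _ cm); last first.
    by rewrite exprn_ge0.
  have -> : b ^+ k / a l ^+ k = (r ^+ k)^-1 by rewrite -expr_div_n -exprVn
    invf_div.
  rewrite powRVN ?exprn_gt0// !powR_expn ?(ltW b0) ?(ltW r0)// /q !exprMn powRN.
  rewrite exprVn.
  have bs0 : (b `^ s) ^+ k != 0 by rewrite expf_neq0// gt_eqF// powR_gt0.
  rewrite le_eqVlt; apply/orP; left; apply/eqP; field; exact: bs0.
(* From level [k0] on, [q ^+ k] pays for the overlap constant 16, the constant [c], and the factor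
   [b ^ (-s)] lost between consecutive scales. *)
have [k0 k0P] := geometric_large (16 * b `^ (- s) / c) q1.
apply/cover_lbdP; apply: (eventually_scales (k0 := k0) b01).
move=> k d k0k d0 /andP[bkd dbk].
have [n Ln] := Lc d d0.
have bk0 : 0 < b ^+ k by rewrite exprn_gt0.
apply: le_trans (cover_number_anti dbk Ln).
rewrite -(ler_pM2l (ltr0n R 16)); apply: le_trans (lower k).
have {}k0P := k0P k k0k; rewrite ler_pdivrMr// in k0P.
apply: (@le_trans _ _ (16 * b `^ (- s) * (b ^+ k) `^ (- s))); last first.
  by rewrite ler_wpM2r ?powR_ge0// [leRHS]mulrC.
rewrite -mulrA ler_pM2l// -powRM ?(ltW b0) ?(ltW bk0)// -exprS.
have bS0 : 0 < b ^+ k.+1 by rewrite exprn_gt0.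
rewrite !powRN lef_pV2 ?posrE ?powR_gt0//.
by apply: ge0_ler_powR; rewrite ?nnegrE// ltW.
Qed.

End SeparatedFamily.

(** * Stopping at a given scale *)

Section Stopping.
Variable R : realType.
Implicit Types (L : set (R * R)) (G : {fset plane_map R}) (l : axis).

(** The properties shared by a carpet with its attractor ([carpet_self_affine]) and by the diagonal
    carpet of a projection ([self_affine_diag]). *)
Definition self_affine G L := [/\ L !=set0, L `<=` unit_box,
  (forall S, S \in G -> admissible L S),
  (forall S l, S \in G -> ratio l S < 1)
  & (forall x, L x -> exists2 S, S \in G & exists2 y, L y & x = map_fun S y)].

(** The summand of [dim_equation], multiplicative under composition. If [l] is the long axis and [t]
    the dimension of p_l L, the first factor is roughly the number of squares, with side the short
    side of the box, that cover S(L). *)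
Definition weight l (t s : R) (S : plane_map R) : R :=
  (ratio l S / ratio (other l) S) `^ t * ratio (other l) S `^ s.

Lemma weight_ge0 l t s S : 0 <= weight l t s S.
Proof. by rewrite mulr_ge0 ?powR_ge0. Qed.

Lemma ratio_bounds G L : self_affine G L -> exists p q,
  [/\ 0 < p < 1, 0 < q < 1 & forall S l, S \in G -> p <= ratio l S <= q].
Proof.
move=> [_ _ GL G1 _].
have r0 S l : S \in G -> 0 < ratio l S.
  by move=> /GL[/(_ l)/andP[]].
have bound l : exists2 p, 0 < p < 1 & forall S, S \in G ->
  p <= ratio l S <= 1 - p.
  have [p /andP[p0 p1] pP] := seq_positive_bound (fun S => r0 S l).
  have [q /andP[q0 q1] qP] : exists2 q, 0 < q < 1 & forall S, S \in G ->
      q <= 1 - ratio l S.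
    by apply: seq_positive_bound => S SG; rewrite subr_gt0 G1.
  exists (Num.min p q); first by rewrite lt_min p0 q0 gt_min p1.
  move=> S SG; rewrite ge_min pP//= lerBrDr -lerBrDl ge_min qP ?orbT//.
have [p1 /andP[p10 p11] p1P] := bound axis1.
have [p2 /andP[p20 p21] p2P] := bound axis2.
exists (Num.min p1 p2), (1 - Num.min p1 p2).
have m0 : 0 < Num.min p1 p2 by rewrite lt_min p10.
have m1 : Num.min p1 p2 < 1 by rewrite gt_min p11.
split; [by rewrite m0|by rewrite subr_gt0 m1 ltrBlDr ltrDl|].
move=> S l SG; have [/andP[a1 a2] /andP[b1 b2]] := (p1P S SG, p2P S SG).
have mp1 : Num.min p1 p2 <= p1 by rewrite ge_min lexx.
have mp2 : Num.min p1 p2 <= p2 by rewrite ge_min lexx orbT.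
by case: l; apply/andP; split; lra.
Qed.

Lemma ratio_iter_bounds G p q : 0 < p < 1 -> 0 < q < 1 ->
  (forall S l, S \in G -> p <= ratio l S <= q) ->
  forall n S l, S \in map_iter G n -> p ^+ n <= ratio l S <= q ^+ n.
Proof.
move=> /andP[p0 _] /andP[q0 _] pq; elim=> [|n IH] S l.
  by rewrite map_iter0 inE => /eqP ->; rewrite ratio_id !expr0 lexx.
move=> /map_iterSP[A AG [B Bn ->]]; rewrite ratio_comp !exprS.
have [/andP[a1 a2] /andP[b1 b2]] := (pq A l AG, IH B l Bn).
rewrite !ler_pM ?exprn_ge0 ?(ltW p0)//.
  exact: le_trans (ltW p0) a1.
by apply: le_trans b1; rewrite exprn_ge0// ltW.
Qed.

Definition stopped p d l (S : plane_map R) :=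
  ratio (other l) S <= ratio l S /\ p * d <= ratio (other l) S <= d.

(** Continue the coding of [x] while both sides exceed [d]. One further map shrinks a side at most
    by the factor [p], so at the first failure both sides are still at least [p * d]; failure occurs
    by level [n] since [q ^+ n <= d]. *)
Lemma stopping_time G L p q d n x : self_affine G L -> 0 < p < 1 ->
  (forall S l, S \in G -> p <= ratio l S <= q) -> 0 < q < 1 ->
  0 < d < 1 -> q ^+ n <= d -> L x ->
  exists l m S, [/\ (m <= n)%N, S \in map_iter G m, stopped p d l S
    & exists2 y, L y & x = map_fun S y].
Proof.
move=> [L0 L01 GL G1 Lcov] p01 pq q01 /andP[d0 d1] qn Lx.
have /andP[p0 _] := p01.
suff step k : (exists l m S, [/\ (m <= k)%N, S \in map_iter G m, stopped p d l S
      & exists2 y, L y & x = map_fun S y]) \/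
    (exists2 S, S \in map_iter G k & (forall l, d < ratio l S) /\
      exists2 y, L y & x = map_fun S y).
  have [//|[S Sn [/(_ axis1) dS _]]] := step n.
  have /andP[_ h] := ratio_iter_bounds p01 q01 pq axis1 Sn.
  by have := lt_le_trans dS (le_trans h qn); rewrite ltxx.
elim: k => [|k [[l [m [S [mk Sm Sd Sx]]]]|[S Sk [Sd [y Ly xE]]]]].
- right; exists map_id; first by rewrite map_iter0 inE.
  by split=> [l|]; [rewrite ratio_id|exists x; rewrite ?map_fun_id].
- by left; exists l, m, S; split=> //; rewrite leqW.
have [T TG [z Lz yE]] := Lcov y Ly.
have STk : map_comp S T \in map_iter G k.+1.
  by rewrite -addn1; apply: map_iter_add; rewrite ?map_iter1.
have STx : exists2 y, L y & x = map_fun (map_comp S T) y.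
  by exists z => //; rewrite map_fun_comp /= -yE.
have ge_pd l : p * d <= ratio l (map_comp S T).
  have /andP[pT _] := pq T l TG.
  by rewrite ratio_comp mulrC ler_pM ?(ltW d0) ?(ltW p0)// ltW.
pose rST l := ratio l (map_comp S T).
have [l lmin] : exists l, rST (other l) <= rST l.
  have [h|h] := leP (rST axis1) (rST axis2); first by exists axis2.
  by exists axis1; rewrite ltW.
have [le_d|gt_d] := leP (rST (other l)) d.
  by left; exists l, k.+1, (map_comp S T); split=> //; split=> //;
    rewrite ge_pd.
right; exists (map_comp S T) => //; split=> //.
by apply: (@axis_cases l) => //; exact: lt_le_trans lmin.
Qed.

End Stopping.

(** * Upper bounds from bounded sums *)

Section UpperBound.
Variable R : realType.
Implicit Types (L : set (R * R)) (G : {fset plane_map R}) (l : axis).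

(** Along the short axis the image has width at most [d], so a cover of the long projection,
    rescaled by the long ratio, already suffices. *)
Lemma stopped_coverable L S p d l k : L `<=` unit_box ->
  admissible L S -> 0 < d -> stopped p d l S ->
  coverable (axis_proj l @` L) (d / ratio l S) k ->
  coverable (map_fun S @` L) d k.
Proof.
move=> L01 [S0 _ _] d0 [_ /andP[_ Sd]] [U [U1 U2]].
have rl0 : 0 < ratio l S by have /andP[] := S0 l.
exists (fun i => map_fun S @` [set z | L z /\ U i (axis_proj l z)]); split.
  move=> i _ _ [z [Lz Uz] <-] [w [Lw Uw] <-]; apply/norm_plane_le.
  apply: (@axis_cases l); rewrite axis_proj_sub !axis_proj_map sim_fun_sub
    normrM.
    by rewrite -/(ratio l S) mulrC -ler_pdivlMr//; exact: U1 Uz Uw.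
  rewrite -/(ratio (other l) S) -[leRHS]mulr1 ler_pM ?normr_ge0//.
  have /andP[z0 z1] := L01 z Lz (other l);
    have /andP[w0 w1] := L01 w Lw (other l).
  by rewrite ler_norml; apply/andP; split; lra.
move=> _ [z Lz <-]; have [i _ Ui] : (\bigcup_i U i) (axis_proj l z).
  by apply: U2; exists z.
by exists i => //; exists z.
Qed.

(** With sides a >= b, the image needs about (a / d) ^ (t + e) sets. As b lies between [p * d] and
    [d], exchanging d and b in the powers t and s costs only constants depending on [p]. *)
Lemma stopped_cover_le L p l t s e : L !=set0 -> L `<=` unit_box ->
  0 < p < 1 -> 0 < e -> cover_ubd (axis_proj l @` L) (t + e) ->
  exists2 C, 0 < C & forall S d, 0 < d -> admissible L S -> stopped p d l S ->
    exists2 k, coverable (map_fun S @` L) d k &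
      k%:R <= C * d `^ (- (s + e)) * weight l t s S.
Proof.
move=> L0 L01 /andP[p0 p1] e0 /(cover_ubd_unif (image_neq0 _ L0)).
move=> /(_ (@scales_proj _ L l L01) p^-1)[C C0 CP].
exists (C * p `^ (- `|t|) * p `^ (- `|s|)).
  by rewrite !mulr_gt0// powR_gt0.
move=> S d d0 SL Sd; have [S0 _ _] := SL.
have [ba /andP[bpd bd]] := Sd.
have /andP[a0 a1] := S0 l; have /andP[b0 _] := S0 (other l).
set a := ratio l S in ba a0 a1 *; set b := ratio (other l) S in ba b0 bpd bd *.
have eta0 : 0 < d / a by rewrite divr_gt0.
have etap : d / a <= p^-1.
  by rewrite ler_pdivrMr// mulrC ler_pdivlMr// mulrC (le_trans bpd).
have [k' pk'] := @scales_proj _ L l L01 _ eta0.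
have [k [pk kE _]] := cover_numberP pk'.
exists k; first exact: (stopped_coverable L01 SL d0 Sd).
have := CP (d / a); rewrite eta0 etap kE => /(_ isT) /le_trans; apply.
have u1 : p <= b / d by rewrite ler_pdivlMr.
have u2 : b / d <= 1 by rewrite ler_pdivrMr// mul1r.
have u0 : 0 < b / d by rewrite divr_gt0.
have pu : 0 < p <= b / d by rewrite p0.
have T1 : (b / d) `^ t <= p `^ (- `|t|) := powR_le_abs t pu u2.
have T2 : 1 <= (b / d) `^ s * p `^ (- `|s|).
  by rewrite powRN -/(_ / _) ler_pdivlMr ?powR_gt0// mul1r powR_ge_abs.
have T3 : a `^ e <= 1.
  by rewrite -(powRr0 a) powR_anti ?a0// ltW.
have e1 : (d / a) `^ (- (t + e)) =
    a `^ e * ((a / b) `^ t * (b / d) `^ t * d `^ (- e)).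
  rewrite -invf_div powRVN ?divr_gt0// powRD_gt0 ?divr_gt0//.
  rewrite -powRM ?divr_ge0 ?ltW// [a / b * _]mulrA divfK ?gt_eqF//.
  by rewrite [(a / d) `^ e]powRM ?invr_ge0 ?ltW// -powR_inv1 ?ltW//
    -powRrM mulN1r; ring.
have e2 : d `^ (- (s + e)) * b `^ s = d `^ (- e) * (b / d) `^ s.
  rewrite powRM ?invr_ge0 ?ltW// opprD powRD_gt0//.
  by rewrite -[d^-1]powR_inv1 ?ltW// -powRrM mulN1r; ring.
rewrite e1 /weight -/a -/b.
have -> : C * p `^ (- `|t|) * p `^ (- `|s|) * d `^ (- (s + e)) *
    ((a / b) `^ t * b `^ s) = C * (a / b) `^ t * p `^ (- `|t|) * p `^ (- `|s|) *
    (d `^ (- (s + e)) * b `^ s) by ring.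
rewrite e2.
apply: (@le_trans _ _ (C * (a / b) `^ t * p `^ (- `|t|) * d `^ (- e)));
  last first.
  have -> : C * (a / b) `^ t * p `^ (- `|t|) * p `^ (- `|s|) *
      (d `^ (- e) * (b / d) `^ s) =
      C * (a / b) `^ t * p `^ (- `|t|) * d `^ (- e)
      * ((b / d) `^ s * p `^ (- `|s|)) by ring.
  by rewrite ler_peMr// !mulr_ge0 ?powR_ge0// ltW.
apply: (@le_trans _ _ (C * (1 * ((a / b) `^ t * (b / d) `^ t * d `^ (- e))))).
  by rewrite ler_pM2l// ler_wpM2r// !mulr_ge0 ?powR_ge0.
rewrite mul1r !mulrA ler_wpM2r ?powR_ge0// ler_wpM2l//.
by rewrite mulr_ge0 ?powR_ge0// ltW.
Qed.

Lemma cover_ubd_of_sums G L (t : axis -> R) s C : self_affine G L ->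
  (forall l t', t l < t' -> cover_ubd (axis_proj l @` L) t') ->
  (forall n l, \sum_(S <- map_iter G n) weight l (t l) s S <= C) ->
  forall s', s < s' -> cover_ubd L s'.
Proof.
move=> GLsa tP sumC s' ss'; have [L0 L01 GL _ _] := GLsa.
have [p [q [p01 q01 pq]]] := ratio_bounds GLsa; have /andP[q0 q1] := q01.
(* One [e] pays for the loss in the dimension of the projections, the other for the number of
   levels. *)
pose e := (s' - s) / 2; have e0 : 0 < e by rewrite divr_gt0// subr_gt0.
have D l : exists2 C, 0 < C & forall S d, 0 < d -> admissible L S ->
    stopped p d l S -> exists2 k, coverable (map_fun S @` L) d k &
      k%:R <= C * d `^ (- (s + e)) * weight l (t l) s S.
  by apply: stopped_cover_le => //; apply: tP; rewrite ltrDl.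
have [D1 D10 D1P] := D axis1; have [D2 D20 D2P] := D axis2.
have C0 : 0 <= C.
  by apply: le_trans (sumC 0%N axis1); rewrite sumr_ge0// => S _;
    exact: weight_ge0.
have qe1 : 1 < q `^ (- e) := powR_neg_gt1 q01 e0.
have [k0 k0P] := polynomial_le_geometric (2 * ((D1 + D2) * C)) 1 qe1.
(* Starting at [k0.+1] forces [k] to be positive, hence [d < 1]. *)
apply/cover_ubdP; apply: (eventually_scales (k0 := k0.+1) q01) => k d k0k d0.
move=> /andP[qd dq].
have d1 : d < 1.
  by rewrite (le_lt_trans dq)// exprn_ilt1 ?(ltW q0) ?q1//; case: k k0k {qd dq}.
have cov l D' : (forall S, admissible L S -> stopped p d l S ->
      exists2 k, coverable (map_fun S @` L) d k &
        k%:R <= D' * d `^ (- (s + e)) * weight l (t l) s S) -> 0 < D' ->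
    exists2 n, coverable [set x | exists m S, [/\ (m < k.+2)%N,
      S \in map_iter G m, stopped p d l S & exists2 y,
        L y & x = map_fun S y]] d n
      & n%:R <= (k.+2%:R * (D' * C)) * d `^ (- (s + e)).
  (* A map that is not stopped contributes the empty set, covered by 0 sets, so the count may run
     over all of [map_iter G m]. *)
  move=> D'P D'0; have kex S : exists k : nat, admissible L S -> 
     coverable [set x | stopped p d l S /\ exists2 y,
       L y & x = map_fun S y] d k /\
        k%:R <= D' * d `^ (- (s + e)) * weight l (t l) s S.
    have [Sd|Sd] := pselect (stopped p d l S); last first.
      exists 0%N => _; split; last first.
        by rewrite !mulr_ge0 ?powR_ge0 ?weight_ge0// ltW.
      by exists (fun=> set0); split=> // x [/Sd].
    have [SL|SL] := pselect (admissible L S); last by exists 0%N => /SL.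
    have [n' c1 c2] := D'P S SL Sd; exists n' => _; split=> //.
    by apply: coverable_subset c1 => x [_ [y Ly ->]]; exists y.
  have [kap kapP] := choice kex.
  exists (\sum_(m <- iota 0 k.+2) \sum_(S <- map_iter G m) kap S)%N.
    apply: (@coverable_seq _ _ _ _ (fun m => [set x | exists S,
      [/\ S \in map_iter G m, stopped p d l S
        & exists2 y, L y & x = map_fun S y]])).
      move=> x [m [S [mk Sm Sd xS]]]; exists m; first by rewrite mem_iota.
      by exists S.
    move=> m _; apply: (@coverable_seq _ _ _ _ (fun S =>
      [set x | stopped p d l S /\ exists2 y, L y & x = map_fun S y])).
      by move=> x [S [Sm Sd xS]]; exists S.
    by move=> S Sm; have [] := kapP S (admissible_iter GL Sm).
  rewrite natr_sum; apply: (@le_trans _ _ (\sum_(m <- iota 0 k.+2)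
    (D' * C * d `^ (- (s + e))))).
    apply: ler_sum => m _; rewrite natr_sum.
    apply: (@le_trans _ _ (\sum_(S <- map_iter G m)
       D' * d `^ (- (s + e)) * weight l (t l) s S)).
      rewrite big_seq [leRHS]big_seq; apply: ler_sum => S Sm.
      by have [] := kapP S (admissible_iter GL Sm).
    rewrite -big_distrr/= -[leRHS]mulrAC ler_wpM2l//.
    by rewrite mulr_ge0 ?powR_ge0// ltW.
  rewrite big_const_seq count_predT size_iota iter_addr addr0 mulr_natl.
  by rewrite mulrnAl.
have [n1 c1 b1] := cov axis1 D1 (fun S => D1P S d d0) D10.
have [n2 c2 b2] := cov axis2 D2 (fun S => D2P S d d0) D20.
have LU := coverable_setU c1 c2.
have {}LU : coverable L d (n1 + n2).
  apply: coverable_subset LU => x Lx.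
  have d01 : 0 < d < 1 by rewrite d0.
  have [l [m [S [mk Sm Sd Sx]]]] := stopping_time GLsa p01 pq q01 d01 qd Lx.
  by case: l Sd => Sd; [left|right]; exists m, S.
apply: (le_trans (cover_number_le LU)); rewrite natrD.
apply: (le_trans (lerD b1 b2)).
have -> : - s' = - (s + e) + - e by rewrite /e; field.
rewrite powRD_gt0// -mulrDl mulrC ler_wpM2l ?powR_ge0//.
have dq' : (q `^ (- e)) ^+ k <= d `^ (- e).
  rewrite -powR_expn ?(ltW q0)// !powRN lef_pV2 ?posrE ?powR_gt0 ?exprn_gt0//.
  by apply: ge0_ler_powR; rewrite ?nnegrE ?exprn_ge0 ?(ltW q0)// ltW.
apply: le_trans dq'; apply: le_trans (k0P k (ltnW k0k)).
have -> : k.+2%:R * (D1 * C) + k.+2%:R * (D2 * C) = (D1 + D2) * C * k.+2%:R by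
  ring.
have -> : 2 * ((D1 + D2) * C) * k.+1%:R ^+ 1 = (D1 + D2) * C * (2 * k.+1)%:R.
  by rewrite natrM; ring.
apply: ler_wpM2l; first by rewrite mulr_ge0// addr_ge0// ltW.
by rewrite ler_nat mul2n -addnn addSn !ltnS leq_addl.
Qed.

End UpperBound.

(** * Classes of maps with equal slopes *)

Section Classes.
Variable R : realType.
Implicit Types (G H E : {fset plane_map R}) (l : axis) (L : set (R * R)).

(** Signed slopes rather than ratios: the boxes of two such maps are translates, and S^-1 T is a
    translation when the slopes are nonzero. *)
Definition same_slopes (S T : plane_map R) :=
  forall l, slope (axis_proj l S) = slope (axis_proj l T).

Lemma same_slopes_ratio S T l : same_slopes S T -> ratio l S = ratio l T.
Proof. by move=> ST; rewrite /ratio ST. Qed.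

Lemma slopes_monomial G m S : S \in map_iter G m -> exists2 c : G -> nat,
  (forall A, c A <= m)%N & forall l, slope (axis_proj l S) =
     \prod_(A : G) slope (axis_proj l (val A)) ^+ c A.
Proof.
elim: m S => [|m IH] S.
  rewrite map_iter0 inE => /eqP ->; exists (fun=> 0%N) => // l.
  by rewrite big1//; case: l.
move=> /map_iterSP[A AG [B /IH[c cm cB] ->]].
exists (fun A' => (c A' + (A' == [` AG]%fset))%N).
  by move=> A'; rewrite (leq_trans (leq_add (cm A') (leq_b1 _)))// addn1.
move=> l; under eq_bigr do rewrite exprD.
rewrite big_split/= -cB [X in _ = _ * X](bigD1 [` AG]%fset)//= eqxx expr1.
rewrite big1 ?mulr1; last by move=> A' /negbTE ->; rewrite expr0.
by rewrite mulrC; case: l.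
Qed.

(* Up to level [n], the slopes depend only on how often each map of [G] is
   used, which leaves at most [n.+1 ^ #|G|] possibilities. *)
Lemma slopes_class G n : exists kappa : plane_map R -> {ffun G -> 'I_n.+1},
  forall S T m k, S \in map_iter G m -> (m <= n)%N -> T \in map_iter G k ->
    (k <= n)%N -> kappa S = kappa T -> same_slopes S T.
Proof.
have ex S : exists c : {ffun G -> 'I_n.+1},
    forall m, S \in map_iter G m -> (m <= n)%N -> forall l,
    slope (axis_proj l S) = \prod_(A : G) slope (axis_proj l (val A)) ^+ c A.
  have [[m [Sm mn]]|no] := pselect (exists m, S \in map_iter G m /\ (m <= n)%N).
    have [c cm cS] := slopes_monomial Sm.
    exists [ffun A => inord (c A)] => _ _ _ l; rewrite cS.
    by apply: eq_bigr => A _; rewrite ffunE inordK// ltnS (leq_trans (cm A)).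
  by exists [ffun=> ord0] => m Sm mn; case: no; exists m.
have [kappa kappaP] := choice ex.
exists kappa => S T m k Sm mn Tk kn e l.
by rewrite (kappaP S m Sm mn) (kappaP T k Tk kn) e.
Qed.

Lemma pigeonhole_sum (I : finType) (f : I -> R) (i0 : I) :
  exists i, \sum_j f j <= #|I|%:R * f i.
Proof.
have [i _ imax] := @arg_maxP _ _ I i0 predT f isT.
exists i; apply: (@le_trans _ _ (\sum_(j : I) f i)).
  by apply: ler_sum => j _; apply: imax.
by rewrite sumr_const mulr_natl.
Qed.

(** Pigeonhole over pairs of a colour and a slope class. The weight is constant on a class, so the
    heaviest class contributes its cardinality times one weight. [E] may mix levels up to [n]. *)
Lemma separated_subfamily G n (I : finType) E (col : plane_map R -> I)
    (w : plane_map R -> R) :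
  (forall S, S \in E -> exists2 m, (m <= n)%N & S \in map_iter G m) ->
  (forall S T, S \in E -> T \in E -> S != T -> same_slopes S T ->
     col S = col T -> disjoint_boxes S T) ->
  (forall S T, same_slopes S T -> w S = w T) ->
  0 < \sum_(S <- E) w S ->
  exists H S0, [/\ {subset H <= E}, S0 \in H,
    forall S, S \in H -> same_slopes S S0, separated H
    & \sum_(S <- E) w S <=
        #|I|%:R * n.+1%:R ^+ #|` G| * (#|` H|%:R * w S0)].
Proof.
move=> EG Ecol w_slopes wE; have [kappa kappaP] := slopes_class G n.
pose J := (I * {ffun G -> 'I_n.+1})%type.
pose cls S : J := (col S, kappa S).
have sumE : \sum_(S <- E) w S = \sum_(j : J) \sum_(S <- E | cls S == j) w S.
  by rewrite (partition_big cls predT).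
have [S1 S1E] : exists S, S \in E.
  apply/fset0Pn; apply: contraTneq wE => ->.
  by rewrite big_seq_fset0 ltxx.
have [j jmax] := pigeonhole_sum (fun j =>
  \sum_(S <- E | cls S == j) w S) (cls S1).
rewrite -sumE in jmax; pose H := [fset S in E | cls S == j]%fset.
have sumH : \sum_(S <- E | cls S == j) w S = \sum_(S <- H) w S.
  by rewrite /H big_fset_condE.
rewrite sumH in jmax.
have [S0 S0H] : exists S, S \in H.
  apply/fset0Pn; apply: contraTneq wE => H0.
  by rewrite -leNgt (le_trans jmax)// H0 big_seq_fset0 mulr0.
have same S T : S \in H -> T \in H -> same_slopes S T /\ col S = col T.
  rewrite !inE => /andP[SE /eqP Sj] /andP[TE /eqP Tj].
  have [m mn Sm] := EG S SE; have [k kn Tk] := EG T TE.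
  have [ce ke] : cls S = cls T by rewrite Sj Tj.
  by split=> //; exact: kappaP Sm mn Tk kn ke.
exists H, S0; split=> //.
- by move=> S; rewrite !inE => /andP[].
- by move=> S SH; have [] := same S S0 SH S0H.
- move=> S T SH TH ST; have [ss cc] := same S T SH TH.
  by apply: Ecol => //; move: SH TH; rewrite !inE => /andP[? _] /andP[? _].
apply: (le_trans jmax); rewrite card_prod card_ffun card_ord natrM -cardfE
  natrX.
rewrite ler_wpM2l//.
rewrite big_seq (eq_bigr (fun=> w S0)); last first.
  by move=> S SH; apply: w_slopes; have [] := same S S0 SH S0H.
by rewrite -big_seq big_const_seq count_predT iter_addr addr0 mulr_natl.
Qed.

(** The projections to axis [l] are intervals of the same length, shifted by at least that
    length. *)
Lemma disjoint_of_shift (S T : plane_map R) l :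
  0 < ratio l S -> slope (axis_proj l S) = slope (axis_proj l T) ->
  ratio l S <= `|(axis_proj l S).2 - (axis_proj l T).2| -> disjoint_boxes S T.
Proof.
move=> S0 ST far z w zP wP /(congr1 (axis_proj l)); rewrite !axis_proj_map => e.
have /andP[z0 z1] := zP l; have /andP[w0 w1] := wP l.
have zw : `|axis_proj l w - axis_proj l z| < 1.
  by rewrite ltr_norml; apply/andP; split; lra.
move: e; rewrite /sim_fun; rewrite /slope in ST; rewrite -ST => e.
have e' : (axis_proj l S).2 - (axis_proj l T).2 =
    (axis_proj l S).1 * (axis_proj l w - axis_proj l z) by rewrite mulrBr; lra.
move: far; rewrite e' normrM -/(ratio l S) leNgt => /negP; apply.
by rewrite -[ltRHS]mulr1 ltr_pM2l.
Qed.

(** Cells of mesh [eta], coloured periodically with period [q.+1]. *)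
Definition grid_color q (eta x : R) : 'I_q.+1 :=
  inord `|(Num.floor (x / eta) %% q.+1)%Z|.

Lemma same_floor (eta x y : R) : 0 < eta ->
  Num.floor (x / eta) = Num.floor (y / eta) -> `|x - y| < eta.
Proof.
move=> eta0 e.
have := floor_itv (x / eta); have := floor_itv (y / eta); rewrite -e.
rewrite !ler_pdivlMr// !ltr_pdivrMr// intrD mulrDl mul1r.
by move=> /andP[h1 h2] /andP[h3 h4]; rewrite ltr_norml; apply/andP; split; lra.
Qed.

(** Indices of distinct cells of one colour differ by at least q + 1, and the positions inside the
    cells lose less than one mesh. *)
Lemma grid_colorP q (eta x y : R) : 0 < eta ->
  grid_color q eta x = grid_color q eta y ->
  Num.floor (x / eta) = Num.floor (y / eta) \/ q%:R * eta <= `|x - y|.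
Proof.
move=> eta0 /(congr1 (@nat_of_ord _)).
have := floor_itv (x / eta); have := floor_itv (y / eta).
set a := Num.floor (x / eta); set b := Num.floor (y / eta).
rewrite !ler_pdivlMr// !ltr_pdivrMr// !intrD !mulrDl !mul1r.
move=> /andP[b1 b2] /andP[a1 a2].
have ge0 (c : int) : 0 <= (c %% q.+1)%Z by exact: modz_ge0.
have lt (c : int) : (`|(c %% q.+1)%Z| < q.+1)%N.
  by rewrite -ltz_nat gez0_abs// ltz_pmod.
rewrite !inordK// => /(congr1 Posz); rewrite !gez0_abs// => /eqP.
rewrite eqz_mod_dvd => /dvdzP[c abc].
have [->|ab] := eqVneq a b; first by left.
have c0 : c != 0.
  by apply: contra_neq ab => c0; apply/eqP; rewrite -subr_eq0 abc c0 mul0r.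
have q0 : 0 <= q.+1%:Z by [].
right; have [h|h] : (b + q.+1%:Z <= a \/ a + q.+1%:Z <= b)%R.
  have [c1|c1] : 1 <= c \/ 1 <= - c by lia.
    by left; have := ler_wpM2r q0 c1; lia.
  by right; have := ler_wpM2r q0 c1; lia.
  have := ler_int R (b + q.+1%:Z) a; rewrite h intrD => h'.
  have {}h' : (b%:~R + q.+1%:R) * eta <= a%:~R * eta by rewrite ler_pM2r.
  rewrite ler_normr; apply/orP; left.
  by move: h'; rewrite -natr1 !mulrDl; lra.
have := ler_int R (a + q.+1%:Z) b; rewrite h intrD => h'.
have {}h' : (a%:~R + q.+1%:R) * eta <= b%:~R * eta by rewrite ler_pM2r.
rewrite ler_normr; apply/orP; right.
by move: h'; rewrite -natr1 !mulrDl; lra.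
Qed.

(** The common form of both separation hypotheses. The palette [I] is the same for all levels; only
    the colouring depends on [n]. *)
Definition colorable G (I : finType) := forall n, (0 < n)%N ->
  exists col : plane_map R -> I, forall S T, S \in map_iter G n ->
    T \in map_iter G n -> S != T -> same_slopes S T -> col S = col T ->
    disjoint_boxes S T.

Lemma separated_colorable G L :
  (forall S, S \in G -> admissible L S) -> separated G -> colorable G unit.
Proof.
move=> GL sepG n _; exists (fun=> tt) => S T Sn Tn ST _ _.
exact: (separated_iter GL sepG Sn Tn).
Qed.

(** For equal slopes f^-1 g is the translation by (g.2 - f.2) / slope f; as the identity is
    isolated, a small translation of this kind must be zero. *)
Lemma weak_separation_shift (F : {fset similarity R}) : weak_separation F ->
  exists2 e, 0 < e & forall n f g, (0 < n)%N ->
    f \in sim_iter F n -> g \in sim_iter F n -> slope f != 0 ->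
    slope f = slope g -> `|f.2 - g.2| < e * `|slope f| -> f = g.
Proof.
move=> [_ [V nV VA]].
have /nbhs_ballP[e /= e0 eV] := nV.
exists e => // n f g n0 fn gn f0 fg close.
have : [set (sim_id : similarity R)] (sim_comp (sim_inv f) g).
  rewrite -VA; split; last first.
    by exists f; [exists n|exists g; [exists n|]].
  apply: eV; rewrite /sim_comp /sim_inv /sim_id;
    rewrite /slope in fg f0 close *.
  split; rewrite /= /ball /=.
    by rewrite -fg mulVf// subrr normr0.
  have -> : 0 - (f.1^-1 * g.2 - f.1^-1 * f.2) = f.1^-1 * (f.2 - g.2) by ring.
  by rewrite normrM normfV mulrC ltr_pdivrMr ?normr_gt0.
rewrite /sim_comp /sim_inv /sim_id /= => -[_ /eqP].
rewrite -mulrBr mulf_eq0 invr_eq0 (negbTE f0) /= subr_eq0 => /eqP e2.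
by rewrite (surjective_pairing f) (surjective_pairing g) -e2; congr pair.
Qed.

(** Translations are coloured with mesh [e] times the ratio. On each axis, the same cell forces
    equal coordinate maps, while distinct cells of one colour are at least one full side apart,
    which makes the boxes disjoint. Distinct maps cannot agree on both axes. *)
Lemma weak_separation_colorable G L :
  (forall S, S \in G -> admissible L S) ->
  (forall l, weak_separation (proj_ifs l G)) ->
  exists q : nat, colorable G ('I_q.+1 * 'I_q.+1)%type.
Proof.
move=> GL wsG.
have [e1 e10 e1P] := weak_separation_shift (wsG axis1).
have [e2 e20 e2P] := weak_separation_shift (wsG axis2).
pose e := Num.min e1 e2; have e0 : 0 < e by rewrite lt_min e10.
pose q := (Num.trunc e^-1).+1.
have qe : 1 <= q%:R * e.
  have ei : 0 <= e^-1 by rewrite invr_ge0 ltW.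
  have /andP[_ h] := truncn_itv ei.
  by rewrite -ler_pdivrMr// div1r ltW.
have eP l n S T : (0 < n)%N -> S \in map_iter G n -> T \in map_iter G n ->
    0 < ratio l S -> same_slopes S T ->
    `|(axis_proj l S).2 - (axis_proj l T).2| < e * ratio l S ->
    axis_proj l S = axis_proj l T.
  move=> n0 Sn Tn S0 ST close.
  have S0' : slope (axis_proj l S) != 0 by rewrite -normr_gt0.
  have mem A : A \in map_iter G n ->
    axis_proj l A \in sim_iter (proj_ifs l G) n.
    by move=> An; rewrite -proj_map_iter; apply/imfsetP; exists A.
  have := mem S Sn; have := mem T Tn; move: S0' close (ST l); rewrite /ratio.
  case: {mem} l S0 => S0 S0' close e' Tm Sm.
    apply: (e1P n) => //; apply: (lt_le_trans close).
    by rewrite ler_wpM2r// ge_min lexx.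
  apply: (e2P n) => //; apply: (lt_le_trans close).
  by rewrite ler_wpM2r// ge_min lexx orbT.
exists q => n n0; exists (fun S =>
  (grid_color q (e * ratio axis1 S) (S.1).2,
    grid_color q (e * ratio axis2 S) (S.2).2)).
move=> S T Sn Tn ST ss [c1 c2].
have r0 l : 0 < ratio l S by have [/(_ l)/andP[]] := admissible_iter GL Sn.
have cl l : axis_proj l S = axis_proj l T \/ disjoint_boxes S T.
  have eta0 : 0 < e * ratio l S by rewrite mulr_gt0.
  have : grid_color q (e * ratio l S) (axis_proj l S).2 =
      grid_color q (e * ratio l S) (axis_proj l T).2.
    by rewrite {2}(same_slopes_ratio l ss); case: (l).
  move=> /(grid_colorP eta0)[/(same_floor eta0)|far].
    by move=> close; left; exact: (eP l n S T n0 Sn Tn (r0 l) ss close).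
  right; apply: (disjoint_of_shift (r0 l) (ss l)); apply: le_trans far.
  by rewrite mulrA ler_peMl// ltW.
have [e1'|dST] := cl axis1; last exact: dST.
have [e2'|dST] := cl axis2; last exact: dST.
by move: ST; rewrite (surjective_pairing S) (surjective_pairing T);
  rewrite /= in e1' e2'; rewrite e1' e2' eqxx.
Qed.

End Classes.

(** * Self-similar sets as diagonal carpets *)

Section BoxDim.
Variables (R : realType) (V : normedModType R).
Implicit Types (A : set V) (s t : R).

Lemma box_ratio_cvg A t : A !=set0 -> coverable_scales A ->
  (forall s, t < s -> cover_ubd A s) -> (forall s, s < t -> cover_lbd A s) ->
  box_ratio A d @[d --> 0^'+] --> t.
Proof.
move=> A0 Ac ub lb; apply/cvgrPdist_le => e e0.
have /cover_ubdP[e1 /andP[e10 e11] u] : cover_ubd A (t + e) by apply: ub;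
  rewrite ltrDl.
have /cover_lbdP[e2 /andP[e20 e21] l] : cover_lbd A (t - e).
  by apply: lb; rewrite ltrBlDr ltrDl.
apply/(@near0P R (fun d => `|t - box_ratio A d| <= e)).
exists (Num.min e1 e2); first by rewrite lt_min e10 e20 gt_min e11.
move=> d /andP[d0]; rewrite le_min => /andP[de1 de2].
have d1 : d < 1 := le_lt_trans de1 e11.
have {}u : cover_number A d <= d `^ (- (t + e)) by apply: u; rewrite d0.
have {}l : d `^ (- (t - e)) <= cover_number A d by apply: l; rewrite d0.
have [n An] := Ac d d0.
have N0 : 0 < cover_number A d := lt_le_trans ltr01 (cover_number_ge1 A0 An).
have ld : 0 < - ln d by rewrite oppr_gt0 ln_lt0// d0.
have {}u : ln (cover_number A d) <= (t + e) * - ln d.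
  by rewrite mulrN -mulNr -ln_powR ler_ln ?posrE ?powR_gt0.
have {}l : (t - e) * - ln d <= ln (cover_number A d).
  by rewrite mulrN -mulNr -ln_powR ler_ln ?posrE ?powR_gt0.
have {}u : box_ratio A d <= t + e by rewrite /box_ratio ler_pdivrMr.
have {}l : t - e <= box_ratio A d by rewrite /box_ratio ler_pdivlMr.
by rewrite ler_norml; apply/andP; split; lra.
Qed.

Lemma box_dim_eq A t : A !=set0 -> coverable_scales A ->
  (forall s, t < s -> cover_ubd A s) -> (forall s, s < t -> cover_lbd A s) ->
  box_dim A = t.
Proof.
move=> A0 Ac ub lb.
exact: (cvg_lim (@norm_hausdorff _ _) (box_ratio_cvg A0 Ac ub lb)).
Qed.

End BoxDim.

Section Diagonal.
Variable R : realType.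
Implicit Types (F : {fset similarity R}) (K : set R) (G : {fset plane_map R}).
Implicit Types (L : set (R * R)) (l : axis).

Definition diag_ifs F : {fset plane_map R} := [fset (f, f) | f in F]%fset.

Definition diag_set K : set (R * R) := [set (x, x) | x in K].

Lemma mem_diag_ifs F f : ((f, f) \in diag_ifs F) = (f \in F).
Proof. by apply/imfsetP/idP => [[g gF [->]]//|fF]; exists f. Qed.

Lemma diag_ifsP F S : reflect (exists2 f, f \in F & S = (f,
  f)) (S \in diag_ifs F).
Proof. exact: (iffP (imfsetP _ _ _ _)). Qed.

Lemma diag_iter F n : map_iter (diag_ifs F) n = diag_ifs (sim_iter F n).
Proof.
elim: n => [|n IH]; apply/fsetP => S.
  apply/idP/diag_ifsP; first by rewrite map_iter0 inE => /eqP ->; exists sim_id;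
    rewrite ?inE.
  by move=> [f]; rewrite inE => /eqP -> ->; rewrite map_iter0 inE.
apply/map_iterSP/diag_ifsP.
  move=> [A /diag_ifsP[f fF ->] [B]]; rewrite IH => /diag_ifsP[g gn ->] ->.
  by exists (sim_comp f g) => //; apply/sim_iterSP; exists f => //; exists g.
move=> [_ /sim_iterSP[f fF [g gn ->]] ->]; exists (f, f);
  first by rewrite mem_diag_ifs.
by exists (g, g) => //; rewrite IH mem_diag_ifs.
Qed.

Lemma proj_diag_ifs F l : proj_ifs l (diag_ifs F) = F.
Proof.
apply/fsetP => f; apply/imfsetP/idP => [[S /diag_ifsP[g gF ->] ->]|fF].
  by case: l.
by exists (f, f); rewrite /= ?mem_diag_ifs//; case: l.
Qed.

Lemma proj_diag_set K l : axis_proj l @` diag_set K = K.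
Proof.
apply/seteqP; split=> [_ [_ [x Kx <-] <-]|x Kx]; first by case: l.
by exists (x, x); [exists x|case: l].
Qed.

Lemma coverable_diag K d n : coverable (diag_set K) d n <-> coverable K d n.
Proof.
split=> -[U [U1 U2]].
  exists (fun i => [set x | U i (x, x)]); split=> [i x y Ux Uy|x Kx].
    by have /norm_plane_le/(_ axis1) := U1 _ _ _ Ux Uy.
  by have [|i _ Ux] := U2 (x, x); [exists x|exists i].
exists (fun i => diag_set (U i)); split.
  move=> i _ _ [x Ux <-] [y Uy <-]; apply/norm_plane_le => -[] /=;
    exact: U1 Ux Uy.
by move=> _ [x /U2[i _ Ux] <-]; exists i => //; exists x.
Qed.

Lemma cover_number_diag K d : cover_number (diag_set K) d = cover_number K d.
Proof. by apply: eq_cover_number => n; exact: coverable_diag. Qed.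

Lemma cover_ubd_diag K s : cover_ubd (diag_set K) s <-> cover_ubd K s.
Proof.
by split=> /cover_ubdP[e e01 H]; apply/cover_ubdP; exists e => // d /H;
  rewrite cover_number_diag.
Qed.

Lemma cover_lbd_diag K s : cover_lbd (diag_set K) s <-> cover_lbd K s.
Proof.
by split=> /cover_lbdP[e e01 H]; apply/cover_lbdP; exists e => // d /H;
  rewrite cover_number_diag.
Qed.

Lemma self_affine_diag G L l : self_affine G L ->
  self_affine (diag_ifs (proj_ifs l G)) (diag_set (axis_proj l @` L)).
Proof.
move=> [L0 L01 GL G1 Lcov].
have ratioE j S : ratio j (axis_proj l S, axis_proj l S) = ratio l S by case: j.
have mapE S x : map_fun (axis_proj l S, axis_proj l S) (x, x) =
    (sim_fun (axis_proj l S) x, sim_fun (axis_proj l S) x) by [].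
split.
- exact/image_neq0/image_neq0.
- move=> _ [_ [z Lz <-] <-] j.
  by have := L01 z Lz l; case: j.
- move=> _ /diag_ifsP[_ /imfsetP[S SG ->] ->]; have [S0 SL So] := GL S SG.
  split=> [j|_ [_ [z Lz <-] <-]|z zP]; first by rewrite ratioE.
    rewrite mapE; exists (sim_fun (axis_proj l S) (axis_proj l z)) => //.
    by exists (map_fun S z); [exact: SL|rewrite axis_proj_map].
  move=> j; pose u := axis_proj j z.
  have /So/(_ l) : open_unit_box (u, u) by move=> k; have := zP j; case: k.
  rewrite !axis_proj_map; have -> : axis_proj l (u, u) = u by case: (l).
  by have -> : axis_proj j (axis_proj l S,
    axis_proj l S) = axis_proj l S by case: (j).
- by move=> _ j /diag_ifsP[_ /imfsetP[S SG ->] ->]; rewrite ratioE G1.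
move=> _ [_ [z Lz <-] <-]; have [S SG [y Ly ->]] := Lcov z Lz.
exists (axis_proj l S, axis_proj l S).
  by rewrite mem_diag_ifs; apply/imfsetP; exists S.
exists (axis_proj l y, axis_proj l y); first by exists (axis_proj l y) => //;
  exists y.
by rewrite mapE axis_proj_map.
Qed.

Lemma fset_transversal (T U : choiceType) (E0 : {fset T}) (f : T -> U) :
  exists2 E : {fset T}, {subset E <= E0} &
    {in E &, injective f} /\ #|` E| = #|` [fset f x | x in E0]%fset|.
Proof.
pose J := [fset f x | x in E0]%fset.
have gex (j : J) : exists x, x \in E0 /\ f x = val j.
  by case: j => _ /= /imfsetP[x /= xE ->]; exists x.
have [g gP] := choice gex.
exists [fset g j | j : J]%fset.
  by move=> _ /imfsetP[j _ ->]; have [] := gP j.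
split.
  move=> _ _ /imfsetP[i _ ->] /imfsetP[j _ ->] e; congr g; apply/val_inj.
  by have [[_ <-] [_ <-]] := (gP i, gP j).
rewrite card_imfset/= ?cardfE ?cardE//.
by move=> i j e; apply/val_inj; have [[_ <-] [_ <-]] := (gP i, gP j); rewrite e.
Qed.

(* The stopped maps of size about [d] fall in at least [N(L, 3 d)] cells of mesh
   [d]; one map per cell, restricted to a slope and colour class, is
   separated. *)
Lemma diag_lbd_of_not_ubd F K s s' :
  self_affine (diag_ifs F) (diag_set K) -> ~ cover_ubd (diag_set K) s ->
  s' < s -> cover_lbd (diag_set K) s'.
Proof.
set G := diag_ifs F; set L := diag_set K => sa nub ss'.
have [L0 L01 GL _ _] := sa.
have [p [q [p01 q01 pq]]] := ratio_bounds sa.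
have /andP[q0 q1] := q01; have /andP[p0 p1] := p01.
(* A single small scale [d] at which more than [(3 * d) ^ (-s)] sets are needed already yields the
   lower bound at [s']. If that bound fails, the upper bound holds at every small scale. *)
apply: contrapT => nlb; apply: nub.
have e0 : 0 < s - s' by rewrite subr_gt0.
have qe1 : 1 < q `^ (- (s - s')) := powR_neg_gt1 q01 e0.
pose g := #|` G|; pose A : R := 3 `^ s; pose P : R := p `^ `|s'|.
(* [A] comes from the scale [3 * d], [P] from stopped sides between [p * d] and [d], and
   [2 * 2 ^+ g] from two colours and k + 2 <= 2 (k + 1); the last 2 makes the final inequality
   strict. *)
pose c0 := A * P^-1 * (2 * 2 ^+ g) * 2.
have [k0 k0P] := polynomial_le_geometric c0 g qe1.
suff [e e01 He] : exists2 e, 0 < e < 1 & forall d, 0 < d <= e ->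
    cover_number L (3 * d) <= (3 * d) `^ (- s).
  apply/cover_ubdP; exists e => // d /andP[d0 de].
  have := He (d / 3); rewrite [3 * _]mulrC divfK ?pnatr_eq0//; apply.
  rewrite divr_gt0// ler_pdivrMr// (le_trans de)// ler_peMr ?ler1n//.
  by case/andP: e01 => /ltW.
apply: (eventually_scales (k0 := k0.+1) q01) => k d k0k d0 /andP[qd dq].
have d1 : d < 1.
  by rewrite (le_lt_trans dq)// exprn_ilt1 ?(ltW q0) ?q1//; case: k k0k {qd dq}.
rewrite leNgt; apply/negP => Ngt; apply: nlb.
pose E0 := [fset S in (\bigcup_(m <- iota 0 k.+2) map_iter G m)%fset |
  `[< stopped p d axis1 S >]]%fset.
have E0P S : S \in E0 <-> exists2 m, (m <= k.+1)%N &
    S \in map_iter G m /\ stopped p d axis1 S.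
  rewrite !inE; split=> [/andP[/bigfcupP[m]]|[m mk [Sm Sd]]].
    by rewrite mem_iota andbT add0n ltnS => mk Sm /asboolP Sd; exists m.
  apply/andP; split; last exact/asboolP.
  by apply/bigfcupP; exists m => //; rewrite mem_iota andbT.
have diagE m S : S \in map_iter G m -> S = (S.1, S.1).
  by rewrite diag_iter => /diag_ifsP[f _ ->].
pose cell (S : plane_map R) := Num.floor ((S.1).2 / d).
have [E EE0 [cell_inj cardE]] := fset_transversal E0 cell.
pose J := [fset cell S | S in E0]%fset; rewrite -/J in cardE.
have Lcov : coverable L (3 * d) #|` J|.
  rewrite cardfE -cardsT -[#|_|](eq_card (A := predT)); last by move=> i;
    rewrite !inE.
  (* A stopped map moves its translation by at most [d] over the unit interval, so the cell is
     widened by [d] on both sides, to length [3 * d]. *)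
  apply: (@coverable_finType _ _ _ _ _ _ (fun j : J => [set z | L z /\
     ((val j)%:~R - 1) * d <= z.1 <= ((val j)%:~R + 2) * d])).
    move=> j _ _ _ [[x Kx <-] /= /andP[x1 x2]] [[y Ky <-] /= /andP[y1 y2]].
    have xy : `|x - y| <= 3 * d by rewrite ler_norml; apply/andP; split; lra.
    by apply/norm_plane_le => -[].
  move=> x Lx; have d01 : 0 < d < 1 by rewrite d0.
  have [l [m [S [mk Sm Sd [y Ly ->]]]]] :=
    stopping_time sa p01 pq q01 d01 qd Lx.
  have SD := diagE m S Sm.
  have Sd1 : stopped p d axis1 S.
    by move: Sd; rewrite SD; case: (l).
  have SE0 : S \in E0 by apply/E0P; exists m.
  have SJ : cell S \in J by apply/imfsetP; exists S.
  exists [` SJ]%fset => //; split;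
    first by have [_ + _] := admissible_iter GL Sm; apply.
  have [_ /andP[_ Sle]] := Sd1; rewrite SD /ratio /slope /= in Sle.
  have /andP[y0 y1] := L01 y Ly axis1.
  have /andP[] : - d <= (S.1).1 * y.1 <= d.
    rewrite -ler_norml normrM -[leRHS]mulr1 ler_pM ?normr_ge0//.
    by rewrite ger0_norm.
  have := floor_itv ((S.1).2 / d); rewrite -/(cell S).
  rewrite ler_pdivlMr// ltr_pdivrMr// intrD mulrDl mul1r /= /sim_fun.
  move=> /andP[c1 c2] h1 h2; rewrite mulrBl mulrDl mul1r.
  by apply/andP; split; lra.
have Jlarge : (3 * d) `^ (- s) < #|` J|%:R.
  exact: lt_le_trans Ngt (cover_number_le Lcov).
pose w S := ratio axis1 S `^ s'.
have wE S : S \in E -> p `^ `|s'| * d `^ s' <= w S.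
  move=> /EE0/E0P[m _ [Sm [_ /andP[]]]]; rewrite (diagE m S Sm) => pS Sd.
  have u1 : 0 < p <= ratio axis1 S / d.
    by rewrite p0 ler_pdivlMr//; rewrite (diagE m S Sm).
  have u2 : ratio axis1 S / d <= 1.
    by rewrite ler_pdivrMr// mul1r (diagE m S Sm).
  have := powR_ge_abs s' u1 u2; rewrite -(ler_pM2r (powR_gt0 s' d0)).
  rewrite -powRM ?divfK ?gt_eqF//; last exact: ltW.
  by rewrite divr_ge0 ?normr_ge0// ltW.
have sumE : #|` J|%:R * (p `^ `|s'| * d `^ s') <= \sum_(S <- E) w S.
  rewrite -cardE mulr_natl -[leLHS]addr0 -iter_addr -[X in iter X]count_predT.
  rewrite -big_const_seq big_seq [leRHS]big_seq; exact: ler_sum.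
have pd0 : 0 < p `^ `|s'| * d `^ s' by rewrite mulr_gt0// powR_gt0.
have sumE0 : 0 < \sum_(S <- E) w S.
  apply: lt_le_trans sumE; rewrite mulr_gt0// (lt_trans _ Jlarge)//.
  by rewrite powR_gt0// mulr_gt0.
(* Two colours suffice: distinct cells of equal parity put translations at least [d] apart, and [d]
   bounds the sides. *)
have [|||H [S0 [HE S0H Hss sepH Hsum]]] := @separated_subfamily _ G k.+1 'I_2 E
    (fun S => grid_color 1 d (S.1).2) w _ _ _ sumE0.
- by move=> S /EE0/E0P[m mk [Sm _]]; exists m.
- move=> S T SE TE ST ss /(grid_colorP d0)[cST|far].
    by move: ST; rewrite (cell_inj S T SE TE cST) eqxx.
  have /EE0/E0P[m mk [Sm [_ /andP[pS Sd]]]] := SE.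
  have /andP[r0 _] : 0 < ratio axis1 S <= 1.
    by have [/(_ axis1)] := admissible_iter GL Sm.
  apply: (@disjoint_of_shift _ S T axis1 r0 (ss axis1)).
  by move: Sd; rewrite (diagE m S Sm) => /le_trans; apply; rewrite -[d]mul1r.
- by move=> S T ss; rewrite /w (same_slopes_ratio axis1 ss).
have /EE0/E0P[m0 m0k [S0m [_ /andP[pS0 S0d]]]] := HE S0 S0H.
have S0D := diagE m0 S0 S0m.
have S0eq l : ratio l S0 = ratio axis1 S0 by rewrite S0D; case: l.
have S0pos : 0 < ratio axis1 S0 by have [/(_ axis1)/andP[]] :=
  admissible_iter GL S0m.
(* The boxes are squares, so the quotient of their sides is 1; with [t = 0] the bound required of
   the projection is [cover_lbd_nonpos]. *)
apply: (@separated_cover_lbd _ L H (fun l => ratio l S0) axis1 0) => //.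
- by move=> S /HE/EE0/E0P[m _ [Sm _]]; exact: (admissible_iter GL Sm).
- by move=> S l SH; apply: same_slopes_ratio; exact: Hss.
- by rewrite S0eq S0pos (le_lt_trans _ d1)// -(S0eq axis2).
- by rewrite S0eq.
- move=> t' t0; apply: cover_lbd_nonpos;
  [exact: image_neq0|exact: scales_proj|].
  exact: ltW.
rewrite powRr0 mul1r S0eq -/(w S0).
have large : c0 * k.+1%:R ^+ g <= d `^ (- (s - s')).
  apply: (le_trans (k0P k (ltnW k0k))).
  rewrite -powR_expn ?(ltW q0)// !powRN lef_pV2 ?posrE ?powR_gt0 ?exprn_gt0//.
  by apply: ge0_ler_powR; rewrite ?nnegrE ?exprn_ge0 ?(ltW q0)// ltW.
set X := (X in 1 < X); set Y : R := k.+1%:R ^+ g in large.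
have X0 : 0 <= X by rewrite mulr_ge0 ?powR_ge0.
have Y0 : 0 < Y by rewrite exprn_gt0.
have A0 : 0 < A by rewrite powR_gt0.
have P0 : 0 < P by rewrite powR_gt0.
rewrite -/P in sumE pd0.
have Hk : k.+2%:R ^+ #|` G| <= 2 ^+ g * Y.
  rewrite -exprMn; apply: lerXn2r; rewrite ?nnegrE ?mulr_ge0//.
  by rewrite -natrM ler_nat mul2n -addnn addSn !ltnS leq_addl.
have up : A^-1 * P * d `^ (- (s - s')) <= 2 * (2 ^+ g * Y) * X.
  rewrite card_ord in Hsum.
  apply: le_trans (le_trans sumE (le_trans Hsum _)); last first.
    by rewrite ler_wpM2r// ler_wpM2l.
  have -> : - (s - s') = - s + s' by ring.
  rewrite powRD_gt0//; apply: (@le_trans _ _ ((3 * d) `^ (- s) * (P * d `^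
    s'))).
    rewrite powRM ?(ltW d0)// [3 `^ _]powRN -/A le_eqVlt; apply/orP; left.
    by apply/eqP; ring.
  by rewrite ler_wpM2r ?ltW.
have low : A^-1 * P * (c0 * Y) <= A^-1 * P * d `^ (- (s - s')).
  by rewrite ler_wpM2l// mulr_ge0 ?invr_ge0 ?(ltW A0) ?(ltW P0).
have {low up} := le_trans low up.
have -> : A^-1 * P * (c0 * Y) = 2 * (2 ^+ g * Y) * 2.
  by rewrite /c0; field; rewrite !gt_eqF.
rewrite ler_pM2l; first by apply: lt_le_trans; rewrite ltr1n.
by rewrite !mulr_gt0 ?exprn_gt0.
Qed.

(** The crude exponent 2 absorbs the constants in 1 / d + 2; it serves only to exclude infinite
    dimensions. *)
Lemma unit_interval_ubd K : K !=set0 -> K `<=` `[0, 1] -> cover_ubd K 2.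
Proof.
move=> K0 K01; apply/cover_ubdP; exists (2^-1).
  by rewrite invr_gt0 ltr0n invf_lt1 ?ltr0n// ltr1n.
move=> d /andP[d0 d2]; have [n Kn nd] := coverable_unit_interval d0 K01.
apply: (le_trans (cover_number_le Kn)); apply: (le_trans nd).
have dV : 2 <= d^-1 by rewrite -[2]invrK lef_pV2 ?posrE ?invr_gt0.
have -> : d `^ (- 2) = d^-1 * d^-1.
  by rewrite powRN powR_mulrn ?ltW// expr2 invfM.
apply: (@le_trans _ _ (2 * d^-1)); last by rewrite ler_pM2r// invr_gt0.
lra.
Qed.

(** By [diag_lbd_of_not_ubd], failure of the upper bound at [s] gives the lower bound at every
    smaller exponent. The supremum of the exponents with a lower bound is therefore the
    dimension. *)
Lemma proj_dim_exists G L l : self_affine G L -> exists2 t : R,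
  forall s, t < s -> cover_ubd (axis_proj l @` L) s &
  forall s, s < t -> cover_lbd (axis_proj l @` L) s.
Proof.
move=> sa; have sad := self_affine_diag l sa; have [L0 L01 _ _ _] := sa.
set K := axis_proj l @` L in sad *.
have K0 : K !=set0 by exact: image_neq0.
have dich s s' : ~ cover_ubd K s -> s' < s -> cover_lbd K s'.
  move=> nub ss'; apply/cover_lbd_diag; apply: (diag_lbd_of_not_ubd sad _ ss').
  by move=> /cover_ubd_diag.
have K2 : cover_ubd K 2 by apply: unit_interval_ubd => //; exact: proj_unit_box.
have lb0 : cover_lbd K 0 by apply: cover_lbd_nonpos => //; exact: scales_proj.
have sA : has_sup [set s | cover_lbd K s].
  by split; [exists 0|exists 2 => s /= /(cover_ubd_lbd_le K2)].
exists (sup [set s | cover_lbd K s]) => s st.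
  apply: contrapT => nub.
  have /(dich _ _ nub) : (s + sup [set s | cover_lbd K s]) / 2 < s by lra.
  by move=> /(ub_le_sup sA.2); lra.
have e0 : 0 < sup [set s | cover_lbd K s] - s by rewrite subr_gt0.
have [s0 s0A] := sup_adherent e0 sA; rewrite opprB addrC subrK => ss0.
exact: cover_lbd_le (ltW ss0) s0A.
Qed.

End Diagonal.

(** * The dimension equations *)

Section ExponentRoot.
Variable R : realType.

Lemma exp_sum_continuous (T : eqType) (E : seq T) (w b : T -> R) :
  continuous (fun d : R => \sum_(x <- E) w x * expR (d * ln (b x))).
Proof.
elim: E => [|x E IH] d.
  by under eq_fun do rewrite big_nil; exact: cst_continuous.
under eq_fun do rewrite big_cons; apply: cvgD; last exact: IH.
apply: cvgMr; apply: continuous_comp; last exact: continuous_expR.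
by apply: cvgMl; exact: cvg_id.
Qed.

(** The sum is continuous and strictly decreasing in [d]. It falls to at most 1 because the bases
    are bounded away from 1, and a single term raises it to at least 1 for negative [d]. *)
Lemma exponent_root (T : eqType) (E : seq T) (w b : T -> R) : E != [::] ->
  (forall x, x \in E -> 0 < w x) -> (forall x, x \in E -> 0 < b x < 1) ->
  exists! d, \sum_(x <- E) w x * b x `^ d = 1.
Proof.
move=> E0 w0 b01; pose F (d : R) := \sum_(x <- E) w x * b x `^ d.
have FE d : F d = \sum_(x <- E) w x * expR (d * ln (b x)).
  rewrite /F big_seq [RHS]big_seq; apply: eq_bigr => x xE;
    rewrite /powR gt_eqF//.
  by have /andP[] := b01 x xE.
have Fcont : continuous F.
  have -> : F = fun d => \sum_(x <- E) w x * expR (d * ln (b x)).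
    by apply/funext => d; exact: FE.
  exact: exp_sum_continuous.
have Fdec d d' : d < d' -> F d' < F d.
  move=> dd'.
  have lt x : x \in E -> w x * b x `^ d' < w x * b x `^ d.
    move=> xE; have /andP[bx0 bx1] := b01 x xE.
    rewrite ltr_pM2l ?w0// /powR gt_eqF// ltr_expR ltr_nM2r// ln_lt0//.
    by rewrite bx0.
  rewrite /F; case: (E) E0 lt => // x E' _ lt; rewrite !big_cons ltr_leD//.
    by apply: lt; rewrite mem_head.
  rewrite big_seq [leRHS]big_seq; apply: ler_sum => y yE.
  by apply/ltW/lt; rewrite inE yE orbT.
have [x0 x0E] : exists x, x \in E.
  by case: (E) E0 => // x E' _; exists x; rewrite mem_head.
have [p /andP[p0 p1] pP] : exists2 p :
  R, 0 < p < 1 & forall x, x \in E -> p <= 1 - b x.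
  by apply: seq_positive_bound => x /b01; rewrite subr_gt0 => /andP[].
pose W := \sum_(x <- E) w x.
have W0 : 0 <= W by rewrite /W big_seq sumr_ge0// => x /w0/ltW.
have q01 : 0 < 1 - p < 1 by rewrite subr_gt0 p1 ltrBlDr ltrDl.
have [N1 N1P] : exists N : nat, F N%:R <= 1.
  have i0 : 0 < (W + 1)^-1 by rewrite invr_gt0 ltr_wpDl.
  have [N /(_ _ (leqnn _)) NP] := geometric_small q01 i0.
  exists N; apply: (@le_trans _ _ (W * (1 - p) ^+ N)).
    rewrite /F /W big_distrl/= big_seq [leRHS]big_seq; apply: ler_sum => x xE.
    have /andP[bx0 bx1] := b01 x xE.
    rewrite ler_wpM2l ?(ltW (w0 _ xE))// powR_mulrn ?(ltW bx0)//.
    rewrite lerXn2r ?nnegrE ?(ltW bx0) ?subr_ge0 ?(ltW p1)//.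
    by have := pP x xE; lra.
  apply: (le_trans (ler_wpM2l W0 NP)).
  by rewrite ler_pdivrMr ?ltr_wpDl// mul1r lerDl.
have [N2 N2P] : exists N : nat, 1 <= F (- N%:R).
  have /andP[bx0 bx1] := b01 x0 x0E.
  have bi : 1 < (b x0)^-1 by rewrite invf_gt1.
  have [N /(_ _ (leqnn _)) NP] := geometric_large (w x0)^-1 bi.
  exists N; apply: (@le_trans _ _ (w x0 * b x0 `^ (- N%:R))).
    rewrite powRN powR_mulrn ?(ltW bx0)// -exprVn.
    by rewrite mulrC -ler_pdivrMr ?w0// mul1r.
  rewrite /F (perm_big _ (perm_to_rem x0E)) big_cons lerDl big_seq sumr_ge0//.
  by move=> x /mem_rem/w0/ltW h; rewrite mulr_ge0 ?powR_ge0.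
have N12 : - N2%:R <= N1%:R :> R.
  by rewrite (@le_trans _ _ 0)// oppr_le0.
have [||d dI Fd] := @IVT R F (- N2%:R) N1%:R 1 N12.
- by apply: continuous_subspaceT => x; exact: Fcont.
- by rewrite ge_min le_max N1P N2P orbT.
exists d; split=> // d' Fd'; apply/eqP; rewrite eq_le !leNgt.
by apply/andP; split; apply/negP => /Fdec; rewrite /F -/(F d) Fd Fd' ltxx.
Qed.

End ExponentRoot.

Section Equations.
Variable R : realType.
Implicit Types (G : {fset plane_map R}) (L : set (R * R)) (l : axis).

Lemma map_iter_neq0 G L n : self_affine G L -> exists S, S \in map_iter G n.
Proof.
move=> [[x Lx] _ _ _ /(_ x Lx)[S SG _]]; elim: n => [|n [T Tn]].
  by exists map_id; rewrite map_iter0 inE.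
by exists (map_comp S T); apply/map_iterSP; exists S => //; exists T.
Qed.

Lemma ratio_iter_lt1 G L n S l : self_affine G L -> (0 < n)%N ->
  S \in map_iter G n -> 0 < ratio l S < 1.
Proof.
move=> sa n0 Sn; have [p [q [p01 q01 pq]]] := ratio_bounds sa.
have [_ _ GL _ _] := sa; have [/(_ l)/andP[-> _] _ _] := admissible_iter GL Sn.
have /andP[_ h] := ratio_iter_bounds p01 q01 pq l Sn.
have /andP[q0 q1] := q01.
by rewrite (le_lt_trans h)// exprn_ilt1 ?(ltW q0) ?q1//; case: (n) n0.
Qed.

Lemma dim_equation_root G L l n a : self_affine G L -> (0 < n)%N ->
  exists! d, dim_equation G l n a d.
Proof.
move=> sa n0; have [S0 S0n] := map_iter_neq0 n sa.
have [||| d [dP dU]] := @exponent_root R _ (map_iter G n)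
  (fun S => (ratio l S / ratio (other l) S) `^ a) (fun S => ratio (other l) S).
- by apply: contraTneq S0n => e; rewrite -[_ \in _]/(_ \in enum_fset _) e.
- move=> S Sn; rewrite powR_gt0// divr_gt0//.
    by have /andP[] := ratio_iter_lt1 l sa n0 Sn.
  by have /andP[] := ratio_iter_lt1 (other l) sa n0 Sn.
- by move=> S Sn; exact: (ratio_iter_lt1 _ sa n0 Sn).
by exists d; split; [exact: esym|move=> d' /esym/dU].
Qed.

Lemma proj_equation_root G L l n : self_affine G L -> (0 < n)%N ->
  exists! s, proj_equation G l n s.
Proof.
move=> sa n0; have [S0 S0n] := map_iter_neq0 n sa.
have [||| s [sP sU]] := @exponent_root R _ (proj_ifs l (map_iter G n))
  (fun=> 1) (fun f => `|slope f|).
- have : axis_proj l S0 \in proj_ifs l (map_iter G n).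
    by apply/imfsetP; exists S0.
  by apply: contraTneq => e; rewrite -[_ \in _]/(_ \in enum_fset _) e.
- by [].
- by move=> _ /imfsetP[S Sn ->]; exact: (ratio_iter_lt1 _ sa n0 Sn).
exists s; split; first by rewrite /proj_equation -sP;
  under [RHS]eq_bigr do rewrite mul1r.
by move=> s' s'P; apply: sU; rewrite -[RHS]s'P; apply: eq_bigr => f _;
  rewrite mul1r.
Qed.

Lemma weight_le_exp G L n S l t s s' : self_affine G L ->
  S \in map_iter G n -> s <= s' -> weight l t s' S <= weight l t s S.
Proof.
move=> [_ _ GL _ _] Sn ss'; rewrite ler_wpM2l ?powR_ge0// powR_anti//.
by have [/(_ (other l))] := admissible_iter GL Sn.
Qed.

Lemma weight_shift (S : plane_map R) l t s x e : (forall l, 0 < ratio l S) ->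
  weight l (t + x) (s + e) S =
  weight l t s S * ((ratio l S / ratio (other l) S) `^ x * ratio (other l) S `^
    e).
Proof.
by move=> S0; rewrite /weight !powRD_gt0 ?divr_gt0//; ring.
Qed.

(* Changing the first exponent by little is outweighed by any increase of the
   second, uniformly over all levels. *)
Lemma weight_perturb G L e : self_affine G L -> 0 < e ->
  exists2 eta, 0 < eta & forall n S l t s x, S \in map_iter G n ->
    `|x| <= eta ->
    weight l (t + x) (s + e) S <= weight l t s S.
Proof.
move=> sa e0; have [p [q [p01 q01 pq]]] := ratio_bounds sa.
have [_ _ GL _ _] := sa.
have /andP[p0 p1] := p01; have /andP[q0 q1] := q01.
have qe1 : 1 < q `^ (- e) := powR_neg_gt1 q01 e0.
have pi0 : 0 < p^-1 by rewrite invr_gt0.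
(* At level n both quotients of the ratios are at most [p ^ (-n)], and the ratios at most [q ^ n].
   This [eta] makes [p ^ (-eta) * q ^ e] less than 1, so the gain wins at every level. *)
have [eta eta0 etaP] := exists_powR_lt pi0 qe1.
exists eta => // n S l t s x Sn xeta.
have [S0 _ _] := admissible_iter GL Sn.
have {}S0 k : 0 < ratio k S by have /andP[] := S0 k.
rewrite weight_shift// ler_piMr ?weight_ge0//.
have bnd k := ratio_iter_bounds p01 q01 pq k Sn.
set a := ratio l S; set b := ratio (other l) S.
have a0 : 0 < a := S0 l; have b0 : 0 < b := S0 (other l).
have /andP[pa _] := bnd l; have /andP[pb qb] := bnd (other l).
have [S1 _ _] := admissible_iter GL Sn.
have /andP[_ a1] := S1 l; have /andP[_ b1] := S1 (other l).
have pn0 : 0 < p ^+ n by rewrite exprn_gt0.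
have pn1 : p ^+ n <= 1 by rewrite exprn_ile1// ltW.
have T1 : (a / b) `^ x <= (p ^+ n)^-1 `^ eta.
  apply: (@le_trans _ _ ((p ^+ n)^-1 `^ `|x|)); last first.
    by apply: ler_powR => //; rewrite invf_ge1.
  have [x0|x0] := leP 0 x.
    rewrite ger0_norm//.
    apply: ge0_ler_powR; rewrite ?nnegrE ?invr_ge0 ?divr_ge0 ?(ltW a0) ?(ltW
      b0) ?(ltW pn0)//.
    apply: (@le_trans _ _ b^-1); first by rewrite ler_piMl ?invr_ge0 ?(ltW b0).
    by rewrite lef_pV2.
  have -> : (a / b) `^ x = (b / a) `^ (- x).
    by rewrite -[b / a]invf_div powRVN ?divr_gt0.
  rewrite ltr0_norm//.
  apply: ge0_ler_powR; rewrite ?nnegrE ?invr_ge0 ?divr_ge0 ?(ltW a0) ?(ltW b0)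
    ?(ltW pn0)//.
    by rewrite oppr_ge0 ltW.
  apply: (@le_trans _ _ a^-1); first by rewrite ler_piMl ?invr_ge0 ?(ltW a0).
  by rewrite lef_pV2.
have T2 : b `^ e <= (q `^ e) ^+ n.
  rewrite -powR_expn ?(ltW q0)//; apply: ge0_ler_powR;
    rewrite ?nnegrE ?exprn_ge0 ?(ltW q0) ?(ltW b0)//.
  exact: ltW.
apply: (le_trans (ler_pM (powR_ge0 _ _) (powR_ge0 _ _) T1 T2)).
rewrite -exprVn powR_expn ?invr_ge0 ?(ltW p0)// -exprMn exprn_ile1//.
  by rewrite mulr_ge0 ?powR_ge0.
have qe0 : q `^ e != 0 by rewrite gt_eqF// powR_gt0.
by rewrite -[leRHS](mulVf qe0) ler_wpM2r ?powR_ge0// -powRN ltW.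
Qed.

(** Removing [n] from the index costs a factor [B n <= 1], which reduces every index to one below
    [n]. *)
Lemma bounded_submultiplicative (B : nat -> R) n : (0 < n)%N ->
  (forall k, 0 <= B k) -> (forall k m, B (k + m)%N <= B k * B m) -> B n <= 1 ->
  exists C, forall k, B k <= C.
Proof.
move=> n0 B0 Bsub Bn; exists (\sum_(j < n) B j) => k.
elim/ltn_ind: k => k IH; have [kn|nk] := ltnP k n.
  by rewrite (bigD1 (Ordinal kn))//= lerDl sumr_ge0.
rewrite -(subnKC nk); apply: (le_trans (Bsub _ _)).
apply: (@le_trans _ _ (B (k - n)%N)); first by rewrite ler_piMl.
by apply: IH; rewrite ltn_subrL n0 (leq_trans n0 nk).
Qed.

Lemma cover_ubd_plane L l s s' : L `<=` unit_box ->
  cover_ubd (axis_proj l @` L) s -> cover_ubd (axis_proj (other l) @` L) s' ->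
  cover_ubd L (s + s').
Proof.
move=> L01 /cover_ubdP[e /andP[e0 e1] He] /cover_ubdP[f /andP[f0 f1] Hf].
apply/cover_ubdP; exists (Num.min e f); first by rewrite lt_min e0 f0 gt_min e1.
move=> d /andP[d0]; rewrite le_min => /andP[de df].
have {}He : cover_number (axis_proj l @` L) d <= d `^ (- s) by apply: He;
  rewrite d0.
have {}Hf : cover_number (axis_proj (other l) @` L) d <= d `^ (- s').
  by apply: Hf; rewrite d0.
have [m' Lm'] := @scales_proj _ L l L01 d d0;
  have [m [Lm mE _]] := cover_numberP Lm'.
have [n' Ln'] := @scales_proj _ L (other l) L01 d d0.
have [n [Ln nE _]] := cover_numberP Ln'.
have Lmn : coverable L d (m * n).
  by case: l Lm Ln {He Hf Lm' Ln' mE nE} => Lm Ln; [|rewrite mulnC];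
    exact: coverable_plane.
apply: (le_trans (cover_number_le Lmn)).
rewrite opprD powRD_gt0// natrM; apply: ler_pM => //.
  by rewrite -mE.
by rewrite -nE.
Qed.

End Equations.

(** * The limit superior of the roots *)

Section Core.
Variable R : realType.
Implicit Types (G : {fset plane_map R}) (L : set (R * R)) (l : axis).

Definition proj_dim L l (t : R) :=
  (forall s, t < s -> cover_ubd (axis_proj l @` L) s) /\
  (forall s, s < t -> cover_lbd (axis_proj l @` L) s).

Definition converges (u : nat -> R) (t : R) :=
  forall e, 0 < e -> exists n0, forall n, (n0 <= n)%N -> `|u n - t| <= e.

Section Sequences.
Variables (G : {fset plane_map R}) (L : set (R * R)) (t : axis -> R).
Variables (tau d : axis -> nat -> R).
Hypotheses (sa : self_affine G L) (dimt : forall l, proj_dim L l (t l)).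
Hypothesis tau_t : forall l, converges (tau l) (t l).
Hypothesis dE : forall l n, (0 < n)%N ->
  \sum_(S <- map_iter G n) weight l (tau l n) (d l n) S = 1.

Lemma tau_close e : 0 < e ->
  exists n0, forall l n, (n0 <= n)%N -> `|tau l n - t l| <= e.
Proof.
move=> e0; have [n1 n1P] := tau_t axis1 e0; have [n2 n2P] := tau_t axis2 e0.
by exists (maxn n1 n2) => l n; rewrite geq_max => /andP[/n1P h1 /n2P h2];
  case: l.
Qed.

(** The exponents [tau] stand both for the constant projected dimensions and for the modified
    exponents s_n. At high levels [weight_perturb] replaces [tau] by its limit at the price of [e],
    so the sums are at most 1; the finitely many other levels go into the constant. *)
Lemma eventually_le_ubd n0 s0 s :
  (forall l n, (n0 <= n)%N -> d l n <= s0) -> s0 < s -> cover_ubd L s.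
Proof.
move=> ds0 s0s; pose e := (s - s0) / 2.
have e0 : 0 < e by rewrite divr_gt0// subr_gt0.
have [eta eta0 etaP] := weight_perturb sa e0.
have [n1 n1P] := tau_close eta0.
pose N := maxn n0 (maxn n1 1).
pose A l n := \sum_(S <- map_iter G n) weight l (t l) (s0 + e) S.
have A0 l n : 0 <= A l n by rewrite sumr_ge0// => S _; exact: weight_ge0.
apply: (@cover_ubd_of_sums _ G L t (s0 + e)
    (1 + \sum_(k < N) (A axis1 k + A axis2 k))) => //.
- by move=> l t'; have [+ _] := dimt l; apply.
- move=> n l; rewrite -/(A l n).
  have [nN|Nn] := ltnP n N.
    rewrite (bigD1 (Ordinal nN))//=;
      apply: (@le_trans _ _ (A axis1 n + A axis2 n)).
      by case: l; rewrite ?lerDl ?lerDr.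
    by rewrite addrCA lerDl addr_ge0// sumr_ge0// => k _; rewrite addr_ge0.
  apply: (@le_trans _ _ 1); last by rewrite lerDl sumr_ge0// => k _;
    rewrite addr_ge0.
  move: Nn; rewrite !geq_max => /and3P[n0n n1n npos].
  rewrite -(dE l npos) /A big_seq [leRHS]big_seq; apply: ler_sum => S Sn.
  apply: (@le_trans _ _ (weight l (tau l n) s0 S)).
    have -> : t l = tau l n + (t l - tau l n) by ring.
    by apply: (etaP n) => //; rewrite distrC n1P.
  by apply: (weight_le_exp _ _ sa Sn); exact: ds0.
- by rewrite /e; lra.
Qed.

(** One sufficiently high level is enough. One half of [s0 - s] pays for replacing [tau] by [t], the
    other for the polynomial loss of the pigeonhole, after which a separated family with equal
    ratios feeds [separated_cover_lbd]. *)
Lemma frequently_ge_lbd (I : finType) s0 s : colorable G I ->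
  (forall n0, exists2 n, (n0 <= n)%N & exists l, s0 <= d l n) -> s < s0 ->
  cover_lbd L s.
Proof.
move=> Gcol freq ss0; pose e := (s0 - s) / 2.
have e0 : 0 < e by rewrite divr_gt0// subr_gt0.
have [L0 L01 GL _ _] := sa.
have [eta eta0 etaP] := weight_perturb sa e0.
have [n1 n1P] := tau_close eta0.
have [p [q [p01 q01 pq]]] := ratio_bounds sa.
have /andP[q0 q1] := q01.
have qe1 : 1 < q `^ (- e) := powR_neg_gt1 q01 e0.
have [k0 k0P] := polynomial_le_geometric (#|I|%:R * 2) #|` G| qe1.
have [n Nn [l s0d]] := freq (maxn k0 (maxn n1 1)).
move: Nn; rewrite !geq_max => /and3P[k0n n1n npos].
have [col colP] := Gcol n npos.
have sum1 : 1 <= \sum_(S <- map_iter G n) weight l (t l) (s + e) S.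
  rewrite -(dE l npos) big_seq [leRHS]big_seq; apply: ler_sum => S Sn.
  apply: (@le_trans _ _ (weight l (tau l n) s0 S)).
    exact: (weight_le_exp _ _ sa Sn).
  have -> : tau l n = t l + (tau l n - t l) by ring.
  have -> : s0 = s + e + e by rewrite /e; field.
  by apply: (etaP n) => //; rewrite n1P.
have [||H [S0 [HE S0H Hss sepH Hsum]]] :=
  @separated_subfamily _ G n I (map_iter G n)
    col (weight l (t l) (s + e)) _ colP _ (lt_le_trans ltr01 sum1).
- by move=> S Sn; exists n.
- by move=> S T ss; rewrite /weight !(same_slopes_ratio _ ss).
have S0n := HE S0 S0H.
pose a k := ratio k S0.
have a01 k : 0 < a k < 1 by exact: (ratio_iter_lt1 k sa npos S0n).
have a0 k : 0 < a k by have /andP[] := a01 k.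
have Ha S k : S \in H -> ratio k S = a k.
  by move=> SH; apply: same_slopes_ratio; exact: Hss.
have HL S : S \in H -> admissible L S.
  by move=> /HE; exact: admissible_iter.
set M : R := #|` H|%:R in Hsum.
pose X := M * weight l (t l) s S0.
have X1 : 1 < X.
  have wle : weight l (t l) (s + e) S0 <= weight l (t l) s S0 * (q `^ e) ^+ n.
    rewrite -[t l in leLHS]addr0 weight_shift//
      powRr0 mul1r ler_wpM2l ?weight_ge0//.
    rewrite -powR_expn ?(ltW q0)//.
    apply: ge0_ler_powR; rewrite ?nnegrE ?exprn_ge0 ?(ltW q0) ?(ltW (a0 _))
      ?(ltW e0)//.
    by have /andP[] := ratio_iter_bounds p01 q01 pq (other l) S0n.
  have := le_trans sum1 Hsum => h.
  have M0 : 0 <= M by [].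
  have Y0 : 0 <= #|I|%:R * n.+1%:R ^+ #|` G| * M.
    by rewrite mulr_ge0// mulr_ge0// exprn_ge0.
  have := k0P n k0n; rewrite powRN exprVn -div1r ler_pdivlMr; last first.
    by rewrite exprn_gt0// powR_gt0.
  set Q := (q `^ e) ^+ n in wle * => kP.
  have h2 : 1 <= #|I|%:R * n.+1%:R ^+ #|` G| * Q * X.
    apply: (le_trans h); rewrite mulrA.
    apply: (le_trans (ler_wpM2l Y0 wle)).
    by rewrite /X le_eqVlt; apply/orP; left; apply/eqP; ring.
  set Z := #|I|%:R * n.+1%:R ^+ #|` G| * Q in h2.
  have Z2 : Z * 2 <= 1.
    by apply: le_trans kP; rewrite /Z le_eqVlt; apply/orP; left; apply/eqP;
      ring.
  have Z0 : 0 <= Z by rewrite !mulr_ge0 ?exprn_ge0 ?powR_ge0.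
  have X0 : 0 <= X by rewrite mulr_ge0 ?weight_ge0.
  rewrite ltNge; apply/negP => X1.
  have : Z * X <= Z by rewrite ler_piMr.
  lra.
have KL k s1 : a (other k) <= a k -> 1 < M * weight k (t k) s1 S0 ->
  cover_lbd L s1.
  move=> ak w1; apply: (@separated_cover_lbd _ L H a k (t k) s1 L0 L01 HL sepH)
    => //.
  by have [] := dimt k.
have [al|al] := leP (a (other l)) (a l); first exact: KL al X1.
set l' := other l in al *; have l'K : other l' = l by rewrite /l' other_axisK.
(* If [l] is the short axis of the family, the weight is rewritten for the other axis. For [s1 = s]
   the correction is [(a l' / a l) ^ (t l + t l' - s)], at least 1 when s does not exceed the sum of
   the projected dimensions. *)
have swap s1 : weight l' (t l') s1 S0 =
    weight l (t l) s S0 * (a l `^ (s1 - (t l + t l')) * a l' `^ (t l + t l' -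
      s)).
  rewrite /weight l'K -/l' -/(a l) -/(a l') !powRM ?invr_ge0 ?(ltW (a0 _))//.
  rewrite -!(powR_inv1 (ltW (a0 _))) -!powRrM !mulN1r.
  rewrite opprD !powRD_gt0// !powRN.
  by field; rewrite !gt_eqF ?powR_gt0.
have [st|st] := leP s (t l + t l').
  apply: (KL l'); rewrite ?l'K; first exact: ltW.
  rewrite swap mulrA -/X; apply: (lt_le_trans X1); rewrite ler_peMr//.
    by rewrite mulr_ge0 ?weight_ge0.
  have -> : a l `^ (s - (t l + t l')) = (a l `^ (t l + t l' - s))^-1.
    by rewrite -powRN opprB.
  rewrite mulrC -/(_ / _) ler_pdivlMr ?powR_gt0// mul1r.
  by apply: ge0_ler_powR; rewrite ?nnegrE ?subr_ge0 ?(ltW (a0 _)) ?(ltW al).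
(* Here [s] exceeds the sum of the projected dimensions, an upper bound for the
   dimension of [L]; the short direction still yields a larger lower bound. *)
have ai0 : 0 < (a l)^-1 by rewrite invr_gt0.
exfalso; have [f f0 fX] := exists_powR_lt ai0 X1.
have lb : cover_lbd L (t l + t l' + f).
  apply: (KL l'); rewrite ?l'K; first exact: ltW.
  rewrite swap mulrA -/X addrAC subrr add0r.
  have h : 1 <= a l' `^ (t l + t l' - s).
    rewrite -(powRr0 (a l')) powR_anti ?a0 ?(ltW (proj2 (andP (a01 l'))))//.
    by rewrite subr_le0 ltW.
  apply: (@lt_le_trans _ _ (X * a l `^ f)); last first.
    rewrite mulrA ler_peMr// mulr_ge0 ?powR_ge0// (le_trans _ (ltW X1))//.
  rewrite -ltr_pdivrMr ?powR_gt0// div1r -powRN.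
  have -> : a l `^ (- f) = (a l)^-1 `^ f.
    by rewrite -[in LHS](invrK (a l)) powRVN ?invr_gt0.
  exact: fX.
have ub : cover_ubd L (t l + f / 4 + (t l' + f / 4)).
  have f4 : 0 < f / 4 by rewrite divr_gt0.
  apply: (@cover_ubd_plane _ L l) => //.
    by have [+ _] := dimt l; apply; rewrite ltrDl.
  by have [+ _] := dimt l'; apply; rewrite ltrDl.
have := cover_ubd_lbd_le ub lb; lra.
Qed.

End Sequences.

(** On the diagonal carpet the quotient of ratios is 1, so its weight sums are the sums of
    [proj_equation]. A single s_n <= t - e would bound all sums at t - e by submultiplicativity and
    force a dimension below t; values s_n above t + e at arbitrarily high levels would force one
    above t. *)
Lemma proj_exponent_cvg G L l t (s : nat -> R) : self_affine G L ->
  proj_dim L l t -> weak_separation (proj_ifs l G) ->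
  (forall n, (0 < n)%N -> proj_equation G l n (s n)) -> converges s t.
Proof.
move=> sa [ub lb] ws sE; pose F := proj_ifs l G; pose D := diag_ifs F.
pose K := axis_proj l @` L.
have sad : self_affine D (diag_set K) := self_affine_diag l sa.
have dimD j : proj_dim (diag_set K) j t.
  by split=> s' h; rewrite proj_diag_set; [exact: ub|exact: lb].
have wD j u v n : \sum_(S <- map_iter D n) weight j u v S =
    \sum_(f <- proj_ifs l (map_iter G n)) `|slope f| `^ v.
  rewrite proj_map_iter diag_iter big_imfset/=; last by move=> f g _ _ [].
  rewrite big_seq [RHS]big_seq; apply: eq_bigr => f fn.
  have fD : (f, f) \in map_iter D n by rewrite diag_iter mem_diag_ifs.
  have [_ _ DL _ _] := sad; have [/(_ j)/andP[f0 _] _ _] :=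
    admissible_iter DL fD.
  rewrite /weight; have -> : ratio (other j) (f, f) = `|slope f| by case: (j).
  have -> : ratio j (f, f) = `|slope f| by case: (j).
  rewrite divff; first by rewrite powR1 mul1r.
  have jf : axis_proj j (f, f) = f by case: (j).
  by move: f0; rewrite /ratio jf => /gt_eqF ->.
have tau_t (j : axis) : converges (fun=> t) t.
  by move=> e e0; exists 0%N => n _; rewrite subrr normr0 ltW.
have dE (j : axis) n : (0 < n)%N ->
  \sum_(S <- map_iter D n) weight j t (s n) S = 1.
  by move=> n0; rewrite wD; exact: sE.
have [_ _ DL _ _] := sad.
have [c colD] : exists c : nat, colorable D ('I_c.+1 * 'I_c.+1)%type.
  by apply: (weak_separation_colorable DL) => j; rewrite proj_diag_ifs.
move=> e e0.
have lower n : (0 < n)%N -> t - e < s n.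
  move=> n0; rewrite ltNge; apply/negP => sne.
  pose B k := \sum_(S <- map_iter D k) weight axis1 t (t - e) S.
  have w0 S : 0 <= weight axis1 t (t - e) S := weight_ge0 _ _ _ _.
  have [C CP] : exists C, forall k, B k <= C.
    apply: (bounded_submultiplicative n0) => [k|k m|].
    - by rewrite sumr_ge0.
    - apply: sum_map_iter_add => // S T; rewrite /weight !ratio_comp.
      by rewrite invfM mulrACA !powRM ?mulr_ge0 ?invr_ge0 ?normr_ge0//; ring.
    - rewrite -(dE axis1 n n0) /B big_seq [leRHS]big_seq;
      apply: ler_sum => S Sn.
      exact: (weight_le_exp _ _ sad Sn).
  have ubK : cover_ubd (diag_set K) (t - e / 2).
    apply: (@cover_ubd_of_sums _ D _ (fun=> t) (t - e) C) => //.
    - by move=> j t'; have [+ _] := dimD j; apply.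
    - by move=> k j; rewrite wD -(wD axis1 t); exact: CP.
    - by lra.
  have lbK : cover_lbd (diag_set K) (t - e / 4) by apply/cover_lbd_diag/lb; lra.
  by have := cover_ubd_lbd_le ubK lbK; lra.
have [n0 n0P] : exists n0, forall n, (n0 <= n)%N -> s n <= t + e.
  apply: contrapT => no; have freq n0 : exists2 n, (n0 <= n)%N &
      exists j : axis, t + e <= s n.
    apply: contrapT => no'; apply: no; exists n0 => n n0n; rewrite leNgt.
    by apply/negP => h; apply: no'; exists n => //; exists axis1; exact: ltW.
  have lbK : cover_lbd (diag_set K) (t + e / 2).
    apply: (frequently_ge_lbd sad dimD tau_t dE colD freq); lra.
  have ubK : cover_ubd (diag_set K) (t + e / 4) by apply/cover_ubd_diag/ub; lra.
  by have := cover_ubd_lbd_le ubK lbK; lra.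
exists (maxn n0 1) => n; rewrite geq_max => /andP[/n0P h1 /lower h2].
by rewrite ler_norml; apply/andP; split; lra.
Qed.

End Core.

Section LimitSuperior.
Variable R : realType.
Implicit Types (u : nat -> \bar R) (s : R).

Lemma limn_esup_lt u s : (limn_esup u < s%:E)%E ->
  exists n0, forall n, (n0 <= n)%N -> (u n < s%:E)%E.
Proof.
rewrite /limn_esup limf_esupE => /ereal_inf_lt[_ [W [n0 _ n0W] <-] Ws].
exists n0 => n n0n; apply: le_lt_trans Ws; apply: ereal_sup_ubound.
by exists n => //; exact: n0W.
Qed.

Lemma lt_limn_esup u s : (s%:E < limn_esup u)%E ->
  forall n0, exists2 n, (n0 <= n)%N & (s%:E < u n)%E.
Proof.
move=> su n0; apply: contrapT => no; move: su; apply/negP; rewrite -leNgt.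
rewrite /limn_esup limf_esupE; pose W := [set n | (n0 <= n)%N].
apply: (@le_trans _ _ (ereal_sup [set u n | n in W])).
  by apply: ereal_inf_lbound; exists W => //; exists n0.
apply: ub_ereal_sup => _ [n Wn <-]; rewrite leNgt; apply/negP => sn.
by apply: no; exists n.
Qed.

End LimitSuperior.

(** * From carpets to the dimension formula *)

Section Carpets.
Variable R : realType.
Implicit Types (G : {fset plane_map R}) (L : set (R * R)) (l : axis).

Lemma convex_affine_preimage (f : similarity R) :
  @convex_set R R^o [set u | 0 <= sim_fun f u <= 1].
Proof.
move=> x y k; rewrite !inE /= => /andP[x0 x1] /andP[y0 y1].
have c0 : 0 <= k%:num :> R by [].
have c1 : k%:num <= 1 :> R by [].
set z := conv k x y; set c : R := k%:num in c0 c1;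
  have -> : z = c * x + (1 - c) * y by [].
have -> : sim_fun f (c * x + (1 - c) * y) = c * sim_fun f x + (1 - c) * sim_fun
  f y.
  by rewrite /sim_fun; ring.
have c1' : 0 <= 1 - c by rewrite subr_ge0.
apply/andP; split; first by rewrite addr_ge0// mulr_ge0.
apply: (@le_trans _ _ (c * 1 + (1 - c) * 1)); first by rewrite lerD// ler_wpM2l.
by rewrite !mulr1 addrC subrK.
Qed.

(** Equal products have equal factors because the factors are non-empty: [z] supplies points of the
    hulls, and 0 a point of the interval. *)
Lemma unit_square_hull_proj L l : L !=set0 -> unit_square_hull L ->
  convex_hull (axis_proj l @` L) = `[0, 1]%classic.
Proof.
move=> [z Lz] hull.
have zP k : convex_hull (axis_proj k @` L) (axis_proj k z).
  by move=> M [_]; apply; exists z.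
have i0 : `[0, 1]%classic (0 : R) by rewrite /= in_itv/= lexx ler01.
have mem a b : (convex_hull (axis_proj axis1 @` L) a /\
    convex_hull (axis_proj axis2 @` L) b) <-> (`[0, 1]%classic a /\ `[0,
      1]%classic b).
  have e : (convex_hull (axis_proj axis1 @` L) `*`
    convex_hull (axis_proj axis2 @` L)) (a, b) = (`[0, 1] `*` `[0, 1]) (a, b).
    by rewrite hull.
  by split=> h; [rewrite -[_ /\ _]/((`[0, 1] `*` `[0, 1]) (a, b)) -e|
    rewrite -[_ /\ _]/((_ `*` _) (a, b)) e].
case: l; apply/seteqP; split=> a aP.
- by have [] := (mem a (axis_proj axis2 z)).1 (conj aP (zP axis2)).
- by have [] := (mem a 0).2 (conj aP i0).
- by have [] := (mem (axis_proj axis1 z) a).1 (conj (zP axis1) aP).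
- by have [] := (mem 0 a).2 (conj i0 aP).
Qed.

Lemma carpet_self_affine G L :
  carpet G -> attractor G L -> unit_square_hull L -> self_affine G L.
Proof.
move=> cG [L0 _ LE] hull.
have projI l z : L z -> 0 <= axis_proj l z <= 1.
  move=> Lz; have : convex_hull (axis_proj l @` L) (axis_proj l z).
    by move=> M [_]; apply; exists z.
  by rewrite unit_square_hull_proj//= in_itv.
have SL S z : S \in G -> L z -> L (map_fun S z).
  by move=> SG Lz; rewrite LE; exists S => //; exists z.
(* The preimage of [0, 1] under p_l S is convex and contains p_l L, hence contains its hull, the
   whole unit interval. *)
have closedS S l u : S \in G -> 0 <= u <= 1 ->
  0 <= sim_fun (axis_proj l S) u <= 1.
  move=> SG uI; have : convex_hull (axis_proj l @` L) u.
    by rewrite unit_square_hull_proj//= in_itv.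
  move=> /(_ [set u | 0 <= sim_fun (axis_proj l S) u <= 1]); apply; split.
    exact: convex_affine_preimage.
  by move=> _ [z Lz <-] /=; rewrite -axis_proj_map projI//; exact: SL.
split=> //.
- by move=> z Lz l; exact: projI.
- move=> S SG; split=> [l|z|z zP l]; first by have /andP[-> /ltW] := cG S SG l.
    exact: SL.
  rewrite axis_proj_map; have /andP[] := zP l; move: (axis_proj l z) => u u0 u1.
  have := closedS S l 0 SG; have := closedS S l 1 SG.
  rewrite !lexx !ler01 => /(_ isT)/andP[h1 h2] /(_ isT)/andP[h3 h4].
  move: h1 h2 h3 h4; have /andP[+ _] := cG S SG l.
  rewrite normr_gt0 /sim_fun /slope mulr0 add0r mulr1.
  move: (axis_proj l S) => [r t] /=; case: (ltgtP r 0) => // r0 _ h1 h2 h3 h4.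
    have : r < r * u by rewrite -[ltLHS]mulr1 ltr_nM2l.
    have : r * u < 0 by rewrite nmulr_rlt0.
    by move=> *; apply/andP; split; lra.
  have : r * u < r by rewrite -[ltRHS]mulr1 ltr_pM2l.
  have : 0 < r * u by rewrite mulr_gt0.
  by move=> *; apply/andP; split; lra.
- by move=> S l SG; have /andP[] := cG S SG l.
move=> x; rewrite {1}LE => -[S SG [y Ly <-]].
by exists S => //; exists y.
Qed.

Lemma proj_box_dim G L l : self_affine G L ->
  proj_dim L l (box_dim (axis_proj l @` L)).
Proof.
move=> sa; have [L0 L01 _ _ _] := sa; have [t ub lb] := proj_dim_exists l sa.
by rewrite (box_dim_eq (image_neq0 _ L0) (scales_proj l L01) ub lb).
Qed.

Lemma limsup_box_dim G L (I : finType) (t : axis -> R) (tau d :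
  axis -> nat -> R) :
  self_affine G L -> colorable G I -> (forall l, proj_dim L l (t l)) ->
  (forall l, converges (tau l) (t l)) ->
  (forall l n, (0 < n)%N -> dim_equation G l n (tau l n) (d l n)) ->
  box_dim_exists L /\
  (box_dim L)%:E = limn_esup (fun n => (Num.max (d axis1 n) (d axis2 n))%:E).
Proof.
move=> sa colG dimt tau_t dE; have [L0 L01 _ _ _] := sa.
have {}dE l n : (0 < n)%N ->
  \sum_(S <- map_iter G n) weight l (tau l n) (d l n) S = 1.
  by move=> n0; rewrite [RHS](dE l n n0).
have Lc := scales_unit_box L01.
set u := fun n => (Num.max (d axis1 n) (d axis2 n))%:E.
have ub s0 s : (limn_esup u < s0%:E)%E -> s0 < s -> cover_ubd L s.
  move=> /limn_esup_lt[n0 n0P];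
    apply: (eventually_le_ubd sa dimt tau_t dE (n0 := n0)).
  move=> l n /n0P; rewrite lte_fin gt_max => /andP[h1 h2].
  by case: l; exact: ltW.
have lb s0 s : (s0%:E < limn_esup u)%E -> s < s0 -> cover_lbd L s.
  move=> /lt_limn_esup freq;
    apply: (frequently_ge_lbd sa dimt tau_t dE colG) => n0.
  have [n n0n] := freq n0; rewrite lte_fin lt_max => un; exists n => //.
  by case/orP: un => /ltW h; [exists axis1|exists axis2].
have ub4 : cover_ubd L (2 + 2).
  by apply: (cover_ubd_plane (l := axis1) L01);
    (apply: unit_interval_ubd; [exact: image_neq0|exact: proj_unit_box]).
have lb0 : cover_lbd L 0 by exact: cover_lbd_nonpos.
(* The value is finite: plus infinity would give the lower bound 5 against the upper bound 4, and
   minus infinity the upper bound -1 against the lower bound 0. *)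
move eqr : (limn_esup u) => x; case: x => [r| |] in eqr *.
- rewrite eqr in ub lb.
  have ubr s : r < s -> cover_ubd L s.
    move=> rs; apply: (ub ((r + s) / 2)); first by rewrite lte_fin; lra.
    lra.
  have lbr s : s < r -> cover_lbd L s.
    move=> rs; apply: (lb ((r + s) / 2)); first by rewrite lte_fin; lra.
    lra.
  split; last by rewrite (box_dim_eq L0 Lc ubr lbr).
  by apply/cvg_ex; exists r; exact: box_ratio_cvg.
- have l6 : ((6 : R)%:E < limn_esup u)%E by rewrite eqr ltry.
  have : cover_lbd L 5 by apply: (lb _ _ l6); clear; lra.
  move=> /(cover_ubd_lbd_le ub4) h; exfalso; move: h; clear; lra.
- have u2 : (limn_esup u < (- 2 : R)%:E)%E by rewrite eqr ltNyr.
  have : cover_ubd L (- 1) by apply: (ub _ _ u2); clear; lra.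
  move=> /cover_ubd_lbd_le/(_ lb0) h; exfalso; move: h; clear; lra.
Qed.

End Carpets.

Theorem theorem1p3 (R : realType) (G : {fset plane_map R})
    (L : set (R * R)) :
  carpet G -> attractor G L -> unit_square_hull L ->
  (weak_separation (proj_ifs axis1 G) /\ weak_separation (proj_ifs axis2 G)) \/
  [/\ coordinate_ordering G, rectangular_osc G
    & weak_separation (proj_ifs axis2 G)] ->
  [/\ forall l n, (0 < n)%N ->
        exists! d, dim_equation G l n (box_dim (axis_proj l @` L)) d,
      box_dim_exists L,
      forall d : axis -> nat -> R,
        (forall l n, (0 < n)%N ->
           dim_equation G l n (box_dim (axis_proj l @` L)) (d l n)) ->
        (box_dim L)%:E
          = limn_esup (fun n => (Num.max (d axis1 n) (d axis2 n))%:E)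
    & forall l : axis, weak_separation (proj_ifs l G) ->
        (forall n, (0 < n)%N -> exists! s, proj_equation G l n s) /\
        forall s : nat -> R,
          (forall n, (0 < n)%N -> proj_equation G l n (s n)) ->
          (forall n, (0 < n)%N -> exists! d, dim_equation G l n (s n) d) /\
          forall d : axis -> nat -> R,
            (forall n, (0 < n)%N -> dim_equation G l n (s n) (d l n)) ->
            (forall n, (0 < n)%N ->
               dim_equation G (other l) n
                 (box_dim (axis_proj (other l) @` L)) (d (other l) n)) ->
            (box_dim L)%:E
              = limn_esup (fun n => (Num.max (d axis1 n) (d axis2 n))%:E)].
Proof.
move=> cG aG hull sep; have sa := carpet_self_affine cG aG hull.
have [_ _ GL _ _] := sa.
have [I colG] : exists I : finType, colorable G I.
  case: sep => [[ws1 ws2]|[_ osc _]]; last first.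
    by exists unit; exact: separated_colorable GL (rectangular_osc_separated
      osc).
  have [|q colq] := weak_separation_colorable GL; first by case.
  by exists ('I_q.+1 * 'I_q.+1)%type.
pose t l := box_dim (axis_proj l @` L).
have dimt l : proj_dim L l (t l) := proj_box_dim l sa.
have const_cvg (c : R) : converges (fun=> c) c.
  by move=> e e0; exists 0%N => n _; rewrite subrr normr0 ltW.
have main := limsup_box_dim sa colG dimt (fun l => const_cvg (t l)).
split.
- by move=> l n n0; exact: dim_equation_root sa n0.
(* Existence of the dimension is asserted without a given sequence, so roots are chosen here; level
   0 gets the default value 0. *)
- have dex (p : axis * nat) : exists d, (0 < p.2)%N ->
      dim_equation G p.1 p.2 (t p.1) d.
    have [->|n0] := posnP p.2; first by exists 0.
    by have [d [dP _]] := dim_equation_root p.1 (t p.1) sa n0; exists d.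
  have [d dP] := choice dex.
  by have [] := main (fun l n => d (l, n)) (fun l n => dP (l, n)).
- by move=> d dE; have [] := main d dE.
move=> l ws; split; first by move=> n n0; exact: proj_equation_root sa n0.
move=> s sE; split; first by move=> n n0; exact: dim_equation_root sa n0.
move=> d dl dl'.
have s_cvg := proj_exponent_cvg sa (dimt l) ws sE.
pose tau k n := match k, l with
  | axis1, axis1 | axis2, axis2 => s n
  | _, _ => t k
  end.
have tau_cvg k : converges (tau k) (t k).
  rewrite /tau; case: (k) (l) s_cvg => -[] s_cvg //; exact: const_cvg.
have dE k n : (0 < n)%N -> dim_equation G k n (tau k n) (d k n).
  by move: dl dl'; rewrite /tau; case: (k) (l) => -[] dl dl' n0;
    [exact: dl|exact: dl'|exact: dl'|exact: dl].
by have [] := limsup_box_dim sa colG dimt tau_cvg dE.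
Qed.
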